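(* Let $\Omega\subset\mathbb{Q}_p$ be a $p$-homogeneous compact open set with $\mathfrak{m}(\Omega)>0$, and let $I_\Omega$ be its set of admissible $p$-orders. (a) A set $\Lambda\subset\mathbb{Q}_p$ is a spectrum of $\Omega$ if and only if $\Lambda$ is a $p$-homogeneous discrete set with $I_\Lambda=\{-i-1:i\in I_\Omega\}$. (b) A set $T\subset\mathbb{Q}_p$ is a tiling complement of $\Omega$ if and only if $T$ is a $p$-homogeneous discrete set with $I_T=\mathbb{Z}\setminus I_\Omega$.
   Context: $p\ge2$ is a prime. $\mathbb{Q}_p$ and $\mathbb{Z}_p$ are the $p$-adic numbers and $p$-adic integers, with valuation $v_p$ and $|x|_p=p^{-v_p(x)}$. $\mathfrak{m}$ is the Haar measure with $\mathfrak{m}(\mathbb{Z}_p)=1$. Balls are $B(a,p^n)=a+p^{-n}\mathbb{Z}_p$. Characters: $\chi(x)=e^{2\pi i\{x\}}$ (with $\{x\}$ the $p$-adic fractional part) and $\chi_y(x)=\chi(yx)$. Spectrum: $\Lambda$ is a spectrum of $\Omega$ if $\{\chi_\lambda|_\Omega\}_{\lambda\in\Lambda}$ is an orthonormal basis of $L^2(\mathfrak{m}|_\Omega/\mathfrak{m}(\Omega))$. Tiling complement: $T$ is a tiling complement of $\Omega$ if $\sum_{t\in T}1_\Omega(x-t)=1$ for a.e. $x$. Admissible $p$-orders: for $E\subset\mathbb{Q}_p$, $I_E=\{v_p(x-y):x,y\in E,\ x\ne y\}$, and $I_E^{\ge n}=\{i\in I_E:i\ge n\}$. $p$-homogeneous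 discrete set: a set $E\subset\mathbb{Q}_p$ with $I_E$ bounded above is $p$-homogeneous if for every $n\in\mathbb{Z}$ and every $a\in\mathbb{Q}_p$, $\sharp(E\cap B(a,p^{-n}))\in\{0,\ p^{\sharp I_E^{\ge n}}\}$. $p$-homogeneous compact open set: let $\mathcal{N}_n(\Omega)$ be the set of balls of radius $p^{-n}$ meeting $\Omega$. $\Omega$ is $p$-homogeneous if for every $n\in\mathbb{Z}$, either every ball of $\mathcal{N}_n(\Omega)$ contains exactly one ball of $\mathcal{N}_{n+1}(\Omega)$, or every ball of $\mathcal{N}_n(\Omega)$ contains exactly $p$ balls of $\mathcal{N}_{n+1}(\Omega)$. *)

(* Defs.v *)
From HB Require Import structures.
From mathcomp Require Import all_boot all_order all_algebra.
From mathcomp Require Import all_classical all_reals all_analysis.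
Set Implicit Arguments. Unset Strict Implicit. Unset Printing Implicit Defensive.
Import Order.TTheory GRing.Theory Num.Theory.
Local Open Scope ring_scope.
Local Open Scope classical_set_scope.

(* An element x of Q_p is represented by its family of canonical truncations *)
(*   tr x k  =  sum_{j < k} a_j p^j  in  Z[1/p] /\ [0, p^k),   k : int,      *)
(* where x = sum_j a_j p^j (a_j in {0..p-1}); i.e. tr x k is the canonical    *)
(* representative of the class x mod p^k Z_p.  The family is coherent         *)
(* (tr x k = tr x (k+1) mod p^k) and vanishes for k small enough.            *)
Section Padic.
Variable p : nat.

Definition pw (k : int) : rat := (p%:R : rat) ^ k.

Definition pmod (r : rat) (k : int) : rat :=
  r - pw k * (Num.floor (r / pw k))%:~R.

Definition qp_valid (f : int -> rat) : Prop :=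
  (forall k : int, f k = pmod (f (k + 1)) k) /\
  (exists N : int, forall k : int, k <= N -> f k = 0).

Record Qp := MkQp { tr : int -> rat ; tr_valid : `[< qp_valid tr >] }.

HB.instance Definition _ := [isSub for tr].
HB.instance Definition _ := [Choice of Qp by <:].

Lemma qp0_valid : `[< qp_valid (fun _ => 0) >].
Proof.
apply/asboolP; split; last by exists 0.
by move=> k; rewrite /pmod mul0r floor0 mulr0 subr0.
Qed.

Definition qp0 : Qp := MkQp qp0_valid.
HB.instance Definition _ := isPointed.Build Qp qp0.

(* (the fallback of insubd is never used when p is prime)                    *)
Definition qsub (x y : Qp) : Qp :=
  insubd x (fun k => pmod (tr x k - tr y k) k).

(* x * y : the truncation of xy mod p^k is the eventual value of             *)
(* (tr x M * tr y M) mod p^k as M -> +oo                                      *)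
Definition qmul (x y : Qp) : Qp :=
  insubd x (fun k => xget 0 [set r : rat | exists M0 : int,
     forall M : int, M0 <= M -> pmod (tr x M * tr y M) k = r]).

(* v_p(z) = i  (z in p^i Z_p but not in p^(i+1) Z_p); v_p(0) = +oo *)
Definition vp_is (z : Qp) (i : int) : Prop := tr z i = 0 /\ tr z (i + 1) <> 0.

Definition pfrac (x : Qp) : rat := tr x 0.

(* the ball B(a, p^n) = a + p^(-n) Z_p = { x | v_p(x - a) >= -n } *)
Definition B (a : Qp) (n : int) : set Qp := [set x | tr x (- n) = tr a (- n)].

Definition Zp : set Qp := B qp0 0.

Definition qp_open (U : set Qp) : Prop :=
  forall x, U x -> exists n : int, B x n `<=` U.

Definition qp_compact (K : set Qp) : Prop :=
  forall (I : Type) (U : I -> set Qp), (forall i, qp_open (U i)) ->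
    K `<=` \bigcup_i U i ->
    exists (n : nat) (f : 'I_n -> I), K `<=` \bigcup_j U (f j).

Definition adm_orders (E : set Qp) : set int :=
  [set i | exists x y, E x /\ E y /\ x <> y /\ vp_is (qsub x y) i].

Local Open Scope card_scope.

Definition p_homogeneous_discrete (E : set Qp) : Prop :=
  (exists M : int, forall i, adm_orders E i -> i <= M) /\
  forall (n : int) (a : Qp),
    (E `&` B a (- n) = set0) \/
    (exists k : nat, [set i | adm_orders E i /\ n <= i] #= `I_k /\
                     (E `&` B a (- n)) #= `I_(p ^ k)%N).

Definition Nballs (O : set Qp) (n : int) : set (set Qp) :=
  [set S | exists a, S = B a (- n) /\ S `&` O !=set0].

(* p-homogeneous compact open set (the compact-open part is stated separately) *)
Definition p_homogeneous_set (O : set Qp) : Prop :=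
  forall n : int,
    (forall S, Nballs O n S -> [set S' | Nballs O (n + 1) S' /\ S' `<=` S] #= `I_1)
 \/ (forall S, Nballs O n S -> [set S' | Nballs O (n + 1) S' /\ S' `<=` S] #= `I_p).

Definition QpB : measurableType _ := g_sigma_algebraType qp_open.

End Padic.

Section Analysis.
Variables (R : realType) (p : nat).
Local Open Scope ereal_scope.

Definition is_haar (mu : {measure set (QpB p) -> \bar R}) : Prop :=
  (forall (A : set (QpB p)) (a : Qp p), measurable A ->
      mu [set x : QpB p | A (qsub x a)] = mu A) /\
  mu (@Zp p : set (QpB p)) = 1.

(* chi_y(x) = chi(yx) = exp(2 pi i {yx}) : real and imaginary parts *)
Definition chi_re (y x : Qp p) : R := cos (2 * pi * ratr (pfrac (qmul y x)))%R.
Definition chi_im (y x : Qp p) : R := sin (2 * pi * ratr (pfrac (qmul y x)))%R.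

(* f = u + i v is in L^2(m|_O) (equivalently of m|_O / m(O)) *)
Definition L2 (mu : {measure set (QpB p) -> \bar R}) (O : set (QpB p))
    (u v : QpB p -> R) : Prop :=
  measurable_fun O u /\ measurable_fun O v /\
  \int[mu]_(x in O) ((u x ^+ 2 + v x ^+ 2)%R)%:E < +oo.

(* Lambda is a spectrum of O: {chi_lambda|_O} is an orthonormal basis of       *)
(* L^2(m|_O / m(O)), with inner product <f,g> = m(O)^-1 \int_O f conj(g).     *)
Definition spectrum (mu : {measure set (QpB p) -> \bar R}) (O : set (QpB p))
    (L : set (Qp p)) : Prop :=
  (forall l l', L l -> L l' ->
     ((fine (mu O))^-1)%:E *
       \int[mu]_(x in O) ((chi_re l x * chi_re l' x + chi_im l x * chi_im l' x)%R)%:E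
       = (if l == l' then 1 else 0) /\
     ((fine (mu O))^-1)%:E *
       \int[mu]_(x in O) ((chi_im l x * chi_re l' x - chi_re l x * chi_im l' x)%R)%:E
       = 0) /\
  (* completeness: the only f in L^2 orthogonal to all chi_lambda is 0 a.e. *)
  (forall u v : QpB p -> R, L2 mu O u v ->
     (forall l, L l ->
        \int[mu]_(x in O) ((u x * chi_re l x + v x * chi_im l x)%R)%:E = 0 /\
        \int[mu]_(x in O) ((v x * chi_re l x - u x * chi_im l x)%R)%:E = 0) ->
     {ae mu, forall x, O x -> u x = 0%R /\ v x = 0%R}).

Definition tiling_complement (mu : {measure set (QpB p) -> \bar R})
    (O : set (QpB p)) (T : set (Qp p)) : Prop :=
  {ae mu, forall x : QpB p, \esum_(t in T) (\1_O (qsub x t) : R)%:E = 1}.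

End Analysis.

(* Main.v *)
Require Import Defs.
From HB Require Import structures.
From mathcomp Require Import all_boot all_order all_algebra all_field.
From mathcomp Require Import all_classical all_reals all_analysis.
From mathcomp Require Import measurable_realfun complex zify ring lra.
Import Order.TTheory GRing.Theory Num.Theory.
Set Implicit Arguments. Unset Strict Implicit. Unset Printing Implicit Defensive.
Local Open Scope ring_scope.
Local Open Scope classical_set_scope.

(* After truncation at a fine enough level, each of the sets Omega, Lambda, T *)
(* becomes a finite set of residues modulo p^d.  Such a set A is              *)
(* p-homogeneous with branching levels J iff the number of its elements in    *)
(* any residue class modulo p^i is 0 or p^#(J /\ [i, d)).  If zeta is a root  *)
(* of unity of exact order p^(i+1), irreducibility of the cyclotomic          *)
(* polynomial shows that \sum_(a in A) zeta^a = 0 iff A is equidistributed    *)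
(* among the p sub-classes of every class modulo p^i; for a p-homogeneous A   *)
(* this happens iff i is in J.  Hence the Fourier transform of 1_Omega        *)
(* vanishes exactly at the xi with - v(xi) - 1 in I_Omega.                    *)
(*                                                                            *)
(* Tilings: A + T = Z/p^d forces T to be equidistributed at all levels        *)
(* outside J, and since #T = p^(d - #J) there is no room for further          *)
(* branching; conversely, sums a + t are distinct because A - A and T - T     *)
(* have disjoint sets of valuations, and they fill Z/p^d by counting.         *)
(*                                                                            *)
(* Spectra: orthogonality forces I_Lambda into - I_Omega - 1; completeness,   *)
(* tested on the indicator of a small ball minus its projection onto the      *)
(* characters of Lambda constant on balls of that size, forces the number of  *)
(* these characters to be the number of balls, so Lambda branches fully.      *)
(* Conversely, sums over a homogeneous Lambda of chi_lambda(s - x) vanish for *)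
(* x outside the small ball around s, so a function orthogonal to all         *)
(* chi_lambda has integral 0 over every small ball, hence is 0 a.e.           *)

(** * Cyclotomic polynomials of prime-power order *)

(** Everything happens at a finite resolution. By [compact_open_levels], [O] lies in p^n0 Z_p and is
    a union of cosets of p^M0 Z_p. Over a window of valuations [n, n + d) a set becomes a list of
    residues modulo p^d ([codes]), valuation n + l becomes level l of a tree, and p-homogeneity
    becomes [hom]; the dictionary is [phd_codes], [codes_phd], [hom_set_branching] and
    [branching_hom].

    The engine is the pair [sum0_equi], [equi_sum0]: a power sum at a root of unity of order p^(i+1)
    vanishes exactly under equidistribution at level i. Its p-adic form [orthogonalP] says that
    chi_l and chi_l' are orthogonal on [O] iff - v(l - l') - 1 is an admissible order of [O].

    Tilings: the tiling equation at x depends only on x modulo p^M0, so it holds everywhere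
    ([tiling_exact]) and descends to Z/p^d ([exact_tiling_tiles]). There the product of the two
    transforms is zero, so the transform of T vanishes wherever that of [O] does not ([tiles_hom]);
    conversely disjoint branching levels make the sums distinct and counting does the rest
    ([hom_tiles]).

    Spectra: orthogonality only limits where a spectrum may branch; completeness supplies the count
    ([spectrum_count]), and [sep_hom] turns an upper bound on branching plus the full count into
    homogeneity. Conversely a homogeneous dual set yields a Dirichlet kernel on [O] ([dual_sum]), so
    a function orthogonal to its characters integrates to zero on small balls ([orth_ball]) and
    vanishes a.e. by a Dynkin argument ([zero_on_balls_ae]). *)

Section CyclotomicPrimePower.
Variables (p : nat) (hp : prime p) (i : nat).

(** This is the cyclotomic polynomial of order p^(i+1), in its explicit form over any field. *)
Definition cyclo_pp (F : fieldType) : {poly F} := \sum_(k < p) 'X^(k * p ^ i).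

Lemma cyclo_pp_mul (F : fieldType) :
  ('X^(p ^ i) - 1) * cyclo_pp F = 'X^(p ^ i.+1) - 1.
Proof.
rewrite [in RHS]expnSr [in RHS]exprM [RHS]subrX1 /cyclo_pp; congr (_ * _).
by apply: eq_bigr => k _; rewrite mulnC exprM.
Qed.

Lemma size_cyclo_pp (F : fieldType) : size (cyclo_pp F) = (totient (p ^ i.+1)).+1.
Proof.
have p0 := prime_gt0 hp.
have q0 : (0 < p ^ i)%N by rewrite expn_gt0 p0.
have q1 : (0 < p ^ i.+1)%N by rewrite expn_gt0 p0.
have n0 : 'X^(p ^ i) - 1 != 0 :> {poly F} by rewrite -size_poly_eq0 size_XnsubC.
have c0 : cyclo_pp F != 0.
  apply/eqP => c0; have := cyclo_pp_mul F; rewrite c0 mulr0 => /esym/eqP.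
  by rewrite -size_poly_eq0 size_XnsubC.
have := congr1 (fun f : {poly F} => size f) (cyclo_pp_mul F).
rewrite size_mul // !size_XnsubC // totient_pfactor //= expnS.
by move: (size _) => s; nia.
Qed.

Lemma cyclo_pp_at_pow1 (F : fieldType) (z : F) : z ^+ (p ^ i) = 1 ->
  (cyclo_pp F).[z] = p%:R.
Proof.
move=> z1; rewrite /cyclo_pp horner_sum (eq_bigr (fun=> 1)).
  by rewrite sumr_const card_ord.
by move=> k _; rewrite hornerXn mulnC exprM z1 expr1n.
Qed.

Lemma root_cyclo_pp (F : fieldType) (z : F) :
  z ^+ (p ^ i.+1) = 1 -> z ^+ (p ^ i) != 1 -> root (cyclo_pp F) z.
Proof.
move=> z1 zn1; have := congr1 (horner^~ z) (cyclo_pp_mul F).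
rewrite hornerM !hornerE z1 subrr => /eqP.
by rewrite mulf_eq0 subr_eq0 (negPf zn1).
Qed.

Lemma map_cyclo_pp (F : fieldType) (f : {rmorphism rat -> F}) :
  map_poly f (cyclo_pp rat) = cyclo_pp F.
Proof. by rewrite /cyclo_pp rmorph_sum; apply: eq_bigr => k _; rewrite /= map_polyXn. Qed.

(** A root z has exact order p^(i+1), because z^(p^i) = 1 would give the value p, which is nonzero.
    The minimal polynomial of z then has the degree of [cyclo_pp], so the two are associated. *)
Lemma cyclo_pp_dvd_algC (z : algC) (f : {poly rat}) :
  root (cyclo_pp algC) z -> root (map_poly ratr f) z -> cyclo_pp rat %| f.
Proof.
move=> rz; have z1 : z ^+ (p ^ i.+1) = 1.
  have := congr1 (horner^~ z) (cyclo_pp_mul algC).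
  by rewrite hornerM (rootP rz) mulr0 !hornerE => /esym/eqP; rewrite subr_eq0 => /eqP.
have zn1 : z ^+ (p ^ i) != 1.
  apply/negP => /eqP zq; have := cyclo_pp_at_pow1 zq; rewrite (rootP rz) => /esym/eqP.
  by rewrite pnatr_eq0 -leqn0 leqNgt prime_gt0.
have prz : (p ^ i.+1).-primitive_root z.
  have [|m prm /dvdn_pfactor [] // j le_ji Em] := prim_order_exists _ z1.
    by rewrite expn_gt0 prime_gt0.
  move: le_ji; rewrite leq_eqVlt => /orP[/eqP <-|]; first by rewrite -Em.
  rewrite ltnS => le_ji; case/negP: zn1; apply/eqP.
  rewrite -(subnK le_ji) expnD mulnC exprM -Em (prim_expr_order prm).
  by rewrite expr1n.
have [g [Dg gm] gP] := minCpolyP z.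
have sg : size g = (totient (p ^ i.+1)).+1.
  have /(congr1 (fun f : {poly algC} => size f)) := minCpoly_cyclotomic prz.
  by rewrite size_cyclotomic Dg size_map_poly.
have gd : g %| cyclo_pp rat by rewrite -gP (map_cyclo_pp ratr).
have : g %= cyclo_pp rat by rewrite -dvdp_size_eqp // sg size_cyclo_pp.
by move=> /eqp_dvdl <-; rewrite -gP.
Qed.

(** The characters take values in R[i], not in [algC]. The transfer goes through the gcd over the
    rationals: it has the root z, hence is not constant, hence has a root in [algC]. *)
Lemma cyclo_pp_dvd (F : numFieldType) (z : F) (f : {poly rat}) :
  z ^+ (p ^ i.+1) = 1 -> z ^+ (p ^ i) != 1 ->
  root (map_poly ratr f) z -> cyclo_pp rat %| f.
Proof.
move=> z1 zn1 rf; have rc := root_cyclo_pp z1 zn1.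
set g := gcdp (cyclo_pp rat) f.
have rg : root (map_poly (ratr : rat -> F) g) z.
  by rewrite /g gcdp_map root_gcd map_cyclo_pp rc.
have c0 : cyclo_pp rat != 0.
  by rewrite -size_poly_eq0 size_cyclo_pp.
have sg : size g != 1%N.
  apply/negP => /size_poly1P [c cn0 gE]; move: rg.
  by rewrite gE /= map_polyC /= /root hornerC fmorph_eq0 (negPf cn0).
have [y ry] : exists y : algC, root (map_poly ratr g) y.
  apply/closed_rootP; rewrite size_map_poly //.
have /andP [ryc ryf] : root (cyclo_pp algC) y && root (map_poly ratr f) y.
  by rewrite -(map_cyclo_pp ratr) -root_gcd -gcdp_map.
exact: cyclo_pp_dvd_algC ryc ryf.
Qed.

End CyclotomicPrimePower.

(** * Homogeneous sets of residues modulo powers of p *)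

Section Levels.
Implicit Type J : pred nat.

Definition lev J (i d : nat) : nat := count J (index_iota i d).

Lemma levdd J d : lev J d d = 0%N.
Proof. by rewrite /lev /index_iota subnn. Qed.

Lemma lev_recl J i d : (i < d)%N -> lev J i d = (J i + lev J i.+1 d)%N.
Proof.
by move=> lt_id; rewrite /lev /index_iota -(subnSK lt_id) /=.
Qed.

Lemma lev_cat J i j d : (i <= j <= d)%N -> lev J i d = (lev J i j + lev J j d)%N.
Proof.
move=> /andP[ij jd]; rewrite /lev /index_iota.
rewrite (_ : (d - i = (j - i) + (d - j))%N); last lia.
by rewrite iotaD count_cat subnKC.
Qed.

Lemma lev_recr J i : lev J 0 i.+1 = (lev J 0 i + J i)%N.
Proof. by rewrite (@lev_cat _ 0 i) ?leq0n //= [lev J i _]lev_recl // levdd addn0. Qed.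

Lemma levC J i d : (lev J i d + lev (predC J) i d = d - i)%N.
Proof. by rewrite /lev count_predC size_iota. Qed.

Lemma eq_lev J J' i d : (forall l, (i <= l < d)%N -> J l = J' l) -> lev J i d = lev J' i d.
Proof. by move=> h; apply: eq_in_count => l; rewrite mem_index_iota; apply: h. Qed.

End Levels.

Section Trees.
Variables (p : nat) (hp : prime p).
Implicit Types (A T : seq nat) (J : pred nat).

Let p0 : (0 < p)%N := prime_gt0 hp.
Let p1 : (1 < p)%N := prime_gt1 hp.
Let pX0 i : (0 < p ^ i)%N. Proof. by rewrite expn_gt0 p0. Qed.

Definition cnt A i c := count (fun a => a == c %[mod p ^ i]) A.

(* The finite tree of residues of A modulo p, p^2, ..., p^d branches fully    *)
(* exactly at the levels in J, and not at all at the other levels.            *)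
Definition hom A J d := forall i c, (i <= d)%N ->
  cnt A i c = 0%N \/ cnt A i c = (p ^ lev J i d)%N.

(** Uniformity over the p sub-classes of each class modulo p^i, tested on neighbouring sub-classes
    only; [equi_child] iterates the shift. *)
Definition equi A i := forall c, cnt A i.+1 (c + p ^ i) = cnt A i.+1 c.

Lemma eq_mod_dvd (a b m n : nat) : (m %| n)%N -> a = b %[mod n] -> a = b %[mod m].
Proof. by move=> mn ab; rewrite -(modn_dvdm a mn) ab modn_dvdm. Qed.

Lemma eq_modX (a b i j : nat) : (i <= j)%N -> a = b %[mod p ^ j] -> a = b %[mod p ^ i].
Proof. by move=> ij; apply: eq_mod_dvd; apply: dvdn_exp2l. Qed.

Lemma child_mod c k i : c + k * p ^ i = c %[mod p ^ i].
Proof. by rewrite addnC modnMDl. Qed.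

Lemma child_exists (a c i : nat) : a = c %[mod p ^ i] ->
  exists2 k, (k < p)%N & a = c + k * p ^ i %[mod p ^ i.+1].
Proof.
(* Adding a multiple of p^(i+1) keeps the class of a and makes the natural-number subtraction of c
   exact. *)
move=> ac; have le : (c <= a + c * p ^ i.+1)%N.
  by apply: leq_trans (leq_addl _ _); apply: leq_pmulr.
have /dvdnP [t Et] : (p ^ i %| a + c * p ^ i.+1 - c)%N.
  rewrite -eqn_mod_dvd // expnSr mulnA addnC; apply/eqP; rewrite -ac.
  by rewrite mulnAC modnMDl.
exists (t %% p)%N; first by rewrite ltn_mod.
rewrite -(modnMDl c a) addnC (_ : a + c * p ^ i.+1 = c + t * p ^ i)%N; last first.
  by rewrite -Et subnKC.
rewrite -[in RHS]modnDmr -[in LHS]modnDmr expnS; congr ((_ + _) %% _)%N.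
by rewrite -!muln_modl modn_mod.
Qed.

Lemma child_uniq (c k k' i : nat) : (k < p)%N -> (k' < p)%N ->
  c + k * p ^ i = c + k' * p ^ i %[mod p ^ i.+1] -> k = k'.
Proof.
move=> kp k'p /eqP; rewrite eqn_modDl expnS -!muln_modl eqn_pmul2r //.
by rewrite !modn_small // => /eqP.
Qed.

Lemma child_indicator (a c i : nat) :
  (\sum_(k < p) (a == c + k * p ^ i %[mod p ^ i.+1]) = (a == c %[mod p ^ i]))%N.
Proof.
have [ac|ac] := boolP (a == c %[mod p ^ i]); last first.
  rewrite big1 // => k _; apply/eqP; rewrite eqb0; apply: contra ac => /eqP ac.
  by rewrite (eq_modX (leqnSn i) ac) child_mod.
have [k kp Ek] := child_exists (eqP ac).
rewrite (bigD1 (Ordinal kp)) //= Ek eqxx big1 ?addn0 // => k' ne.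
apply/eqP; rewrite eqb0; apply: contra ne => /eqP h.
by apply/eqP/val_inj => /=; rewrite (child_uniq (ltn_ord _) kp (esym h)).
Qed.

Lemma cnt_split A i c : cnt A i c = (\sum_(k < p) cnt A i.+1 (c + k * p ^ i))%N.
Proof.
rewrite /cnt; elim: A => [|a A IH] /=; first by rewrite big1.
by rewrite IH big_split /= child_indicator.
Qed.

Lemma cnt0 A c : cnt A 0 c = size A.
Proof. by rewrite /cnt expn0 (eq_count (a2 := predT)) ?count_predT // => a; rewrite !modn1 eqxx. Qed.

Lemma cnt_mod A i c c' : c = c' %[mod p ^ i] -> cnt A i c = cnt A i c'.
Proof. by move=> h; apply: eq_count => a; rewrite h. Qed.

Lemma cnt_gt0 A i c : (0 < cnt A i c)%N <-> exists2 a, a \in A & a = c %[mod p ^ i].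
Proof.
rewrite -has_count; split => [/hasP [a aA /eqP h]|[a aA h]]; first by exists a.
by apply/hasP; exists a => //; apply/eqP.
Qed.

Lemma cnt_gt0_mem A i a : a \in A -> (0 < cnt A i a)%N.
Proof. by move=> aA; apply/cnt_gt0; exists a. Qed.

Lemma cnt_child_le A i c k : (cnt A i.+1 (c + k * p ^ i) <= cnt A i c)%N.
Proof.
apply: sub_count => a /eqP h; apply/eqP.
by rewrite (eq_modX (leqnSn i) h) child_mod.
Qed.

Lemma cntS_le A i c : (cnt A i.+1 c <= cnt A i c)%N.
Proof. by have := cnt_child_le A i c 0; rewrite addn0. Qed.

Lemma sum_eq_bound n (f : 'I_n -> nat) m : (forall k, (f k <= m)%N) ->
  (\sum_k f k = n * m)%N -> forall k, f k = m.
Proof.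
move=> le E k; apply/eqP; rewrite eqn_leq le /= leqNgt; apply/negP => lt.
move: E; apply/eqP; rewrite neq_ltn; apply/orP; left.
have -> : (n * m = \sum_(k < n) m)%N by rewrite sum_nat_const card_ord.
rewrite (bigD1 k) //= [ltnRHS](bigD1 k) //= -addSn leq_add //.
exact: leq_sum.
Qed.

Lemma equi_child A i c k : equi A i -> cnt A i.+1 (c + k * p ^ i) = cnt A i.+1 c.
Proof.
by move=> eqA; elim: k => [|k IH]; rewrite ?addn0 // mulSnr addnA eqA.
Qed.

Lemma equi_cnt A i c : equi A i -> cnt A i c = (p * cnt A i.+1 c)%N.
Proof.
move=> eqA; rewrite cnt_split (eq_bigr (fun=> cnt A i.+1 c)); last first.
  by move=> k _; rewrite equi_child.
by rewrite sum_nat_const card_ord.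
Qed.

Lemma hom_full A J d i a : hom A J d -> a \in A -> (i <= d)%N ->
  cnt A i a = (p ^ lev J i d)%N.
Proof. by move=> hA aA id; have := cnt_gt0_mem i aA; case: (hA i a id) => ->. Qed.

(** The p sub-classes have counts bounded by p^(lev J i.+1 d), and their sum is zero or attains p
    times this bound, so all are equal. *)
Lemma hom_equi A J d i : hom A J d -> (i < d)%N -> J i -> equi A i.
Proof.
move=> hA id Ji c.
have bnd k : (cnt A i.+1 (c + k * p ^ i) <= p ^ lev J i.+1 d)%N.
  by case: (hA i.+1 (c + k * p ^ i)%N id) => ->.
have [z|f] := hA i c (ltnW id).
  have := cnt_child_le A i c 1; have := cnt_child_le A i c 0.
  by rewrite mul0n addn0 mul1n z !leqn0 => /eqP -> /eqP ->.
have := @sum_eq_bound p (fun k => cnt A i.+1 (c + k * p ^ i)) _ bnd.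
rewrite -cnt_split f (lev_recl _ id) Ji expnS => /(_ erefl) h.
have := h (Ordinal p0); have := h (Ordinal p1) => /=.
by rewrite mul0n addn0 mul1n => -> ->.
Qed.

Lemma hom_not_equi A J d i a : hom A J d -> a \in A -> (i < d)%N -> ~~ J i ->
  ~ equi A i.
Proof.
move=> hA aA id nJ eqA; have := equi_cnt a eqA.
rewrite !(hom_full hA aA) // 1?ltnW // (lev_recl _ id) (negPf nJ) add0n.
by move: (pX0 (lev J i.+1 d)); nia.
Qed.

(** Equidistribution forces branching at the levels of J, and the size leaves no room for more:
    every nonempty class is squeezed between a bound obtained from below and one obtained from the
    root. *)
Lemma equi_hom A J d : (forall i, (i < d)%N -> J i -> equi A i) ->
  size A = (p ^ lev J 0 d)%N -> hom A J d.
Proof.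
move=> eqA sA.
(* From the leaves upwards: a level of J multiplies the count by p, and any other level keeps at
   least one child. *)
have low k : forall i c, (i <= d)%N -> (d - i = k)%N ->
    (0 < cnt A i c)%N -> (p ^ lev J i d <= cnt A i c)%N.
  elim: k => [|k IH] i c id Ek c0.
    have Ei : i = d by lia.
    by move: c0; rewrite Ei levdd.
  have lid : (i < d)%N by lia.
  rewrite (lev_recl _ lid); have [Ji|nJ] := boolP (J i).
    rewrite (equi_cnt c (eqA i lid Ji)) expnS leq_mul2l IH ?orbT //; first lia.
    by move: c0; rewrite (equi_cnt c (eqA i lid Ji)); case: (cnt _ _ _) => //; rewrite muln0.
  have /cnt_gt0 [a aA Ea] := c0; have [j _ Ej] := child_exists Ea.
  apply: leq_trans (cnt_child_le A i c j); apply: IH => //; first lia.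
  by apply/cnt_gt0; exists a.
(* From the root downwards: each level of J above i provides p classes of equal count. *)
have up i c : (i <= d)%N -> (cnt A i c * p ^ lev J 0 i <= size A)%N.
  elim: i c => [|i IH] c id; first by rewrite levdd muln1 cnt0.
  rewrite lev_recr; apply: leq_trans (IH c (ltnW id)).
  have [Ji|nJ] := boolP (J i).
    by rewrite (equi_cnt c (eqA i id Ji)) addn1 expnS mulnA (mulnC p).
  by rewrite addn0 leq_mul2r cntS_le orbT.
move=> i c id; have [->|c0] := posnP (cnt A i c); [by left|right].
apply/eqP; rewrite eqn_leq (low _ i c id erefl c0) andbT.
have := up i c id; rewrite sA (@lev_cat _ 0 i d) // expnD mulnC.
by rewrite leq_pmul2l.
Qed.

(** Dual to [equi_hom]: here branching outside J is excluded. This bounds every class by p^(lev J i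
    d), and since the root attains its bound, so does every nonempty class under it. *)
Lemma sep_hom A J d :
  (forall i, (i < d)%N -> ~~ J i -> {in A &, forall a b,
     a = b %[mod p ^ i] -> a = b %[mod p ^ i.+1]}) ->
  (forall c, (cnt A d c <= 1)%N) ->
  size A = (p ^ lev J 0 d)%N -> hom A J d.
Proof.
move=> sep c1 sA.
have single i c : (i < d)%N -> ~~ J i -> (0 < cnt A i.+1 c)%N -> cnt A i.+1 c = cnt A i c.
  move=> id nJ /cnt_gt0 [a aA Ea]; apply: eq_in_count => b bA.
  apply/eqP/eqP => [|h]; first exact: eq_modX.
  by rewrite -Ea; apply: sep => //; rewrite h (eq_modX _ Ea).
have up k : forall i c, (i <= d)%N -> (d - i = k)%N -> (cnt A i c <= p ^ lev J i d)%N.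
  elim: k => [|k IH] i c id Ek.
    have -> : i = d by lia.
    by rewrite levdd.
  have lid : (i < d)%N by lia.
  rewrite (lev_recl _ lid); have [Ji|nJ] := boolP (J i).
    rewrite cnt_split expnS -[p in (p * _)%N](card_ord p) -sum_nat_const leq_sum // => j _.
    by apply: IH => //; lia.
  have [->//|c0] := posnP (cnt A i c).
  have /cnt_gt0 [a aA Ea] := c0.
  rewrite (cnt_mod _ (esym Ea)) -single ?cnt_gt0_mem //.
  by apply: IH => //; lia.
elim=> [|i IH] c id; first by right; rewrite cnt0.
have [->|c0] := posnP (cnt A i.+1 c); [by left|right].
have := IH c (ltnW id); have cle := cntS_le A i c.
case => Ec; first by move: c0 cle; rewrite Ec; case: (cnt _ _ _).
move: Ec; rewrite (lev_recl _ id); have [Ji|nJ] := boolP (J i); last first.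
  by rewrite -single.
rewrite expnS cnt_split => Ec.
have := sum_eq_bound _ Ec => /(_ (fun k => up _ _ _ id erefl) (Ordinal p0)) /=.
by rewrite mul0n addn0.
Qed.

(** At a level outside J parent and child have equal counts, so a parent cannot contain two disjoint
    nonempty children. *)
Lemma hom_level A J d i a b : hom A J d -> a \in A -> b \in A -> (i < d)%N ->
  a = b %[mod p ^ i] -> a <> b %[mod p ^ i.+1] -> J i.
Proof.
move=> hA aA bA id ab nab; apply: contraT => nJ.
have := hom_full hA aA (ltnW id).
have := hom_full hA aA id; have := hom_full hA bA id.
rewrite (lev_recl _ id) (negPf nJ) add0n => Eb Ea E.
have : (cnt A i.+1 a + cnt A i.+1 b <= cnt A i a)%N.
  rewrite /cnt -count_predUI [X in (_ + X)%N](eq_count (a2 := pred0)); last first.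
    move=> c /=; apply/negP => /andP [/eqP h1 /eqP h2].
    by apply: nab; rewrite -h1.
  rewrite count_pred0 addn0; apply: sub_count => c /= /orP [] /eqP h; apply/eqP.
    exact: eq_modX h.
  by rewrite ab; apply: eq_modX h.
by rewrite Ea Eb E; move: (pX0 (lev J i.+1 d)); lia.
Qed.

Lemma hom_child A J d i a k : hom A J d -> a \in A -> (i < d)%N -> J i ->
  exists2 b, b \in A & b = a + k * p ^ i %[mod p ^ i.+1].
Proof.
move=> hA aA id Ji; apply/cnt_gt0; rewrite (equi_child _ _ (hom_equi hA id Ji)).
exact: cnt_gt0_mem.
Qed.

Lemma split_level a b d : a <> b %[mod p ^ d] ->
  exists2 i, (i < d)%N & a = b %[mod p ^ i] /\ a <> b %[mod p ^ i.+1].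
Proof.
elim: d => [|d IH] ab; first by rewrite expn0 !modn1 in ab.
have [E|/eqP/IH [i id h]] := eqVneq (a %% p ^ d)%N (b %% p ^ d)%N; first by exists d.
by exists i; first exact: ltnW.
Qed.

(** * Vanishing power sums at roots of unity and equidistribution *)

Section CharacterSums.
Variables (F : numFieldType) (z : F) (i : nat).
Hypotheses (z1 : z ^+ (p ^ i.+1) = 1) (zn1 : z ^+ (p ^ i) != 1).

Lemma expr_eqmod a b : a = b %[mod p ^ i.+1] -> z ^+ a = z ^+ b.
Proof.
by move=> ab; rewrite -(expr_mod a z1) ab expr_mod.
Qed.

Lemma sum_cnt A : \sum_(a <- A) z ^+ a =
  \sum_(r < p ^ i) \sum_(k < p) (cnt A i.+1 (r + k * p ^ i))%:R * z ^+ (r + k * p ^ i).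
Proof.
have E a : z ^+ a = \sum_(r < p ^ i) \sum_(k < p)
    (a == r + k * p ^ i %[mod p ^ i.+1])%:R * z ^+ (r + k * p ^ i).
  transitivity (\sum_(r < p ^ i) (a == r %[mod p ^ i])%:R * z ^+ a).
    have ha : (a %% p ^ i < p ^ i)%N by rewrite ltn_mod.
    rewrite (bigD1 (Ordinal ha)) //= modn_mod eqxx mul1r big1 ?addr0 // => r ne.
    case: eqP => [h|_]; last by rewrite mul0r.
    by case/eqP: ne; apply: val_inj; rewrite /= h modn_small.
  apply: eq_bigr => r _; rewrite -child_indicator natr_sum mulr_suml.
  by apply: eq_bigr => k _; case: eqP => [h|_]; rewrite ?mul0r // (expr_eqmod h).
rewrite /cnt; elim: A => [|a A IH] /=.
  by rewrite big_nil big1 // => r _; rewrite big1 // => k _; rewrite mul0r.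
rewrite big_cons IH E -big_split; apply: eq_bigr => r _.
by rewrite -big_split; apply: eq_bigr => k _; rewrite natrD mulrDl.
Qed.

Lemma sum_cnt_mod A :
  \sum_(a <- A) z ^+ a = \sum_(c < p ^ i.+1) (cnt A i.+1 c)%:R * z ^+ c.
Proof.
rewrite /cnt; elim: A => [|a A IH] /=.
  by rewrite big_nil big1 // => r _; rewrite mul0r.
rewrite big_cons IH.
have -> : z ^+ a = \sum_(c < p ^ i.+1) (a == c %[mod p ^ i.+1])%:R * z ^+ c.
  have ha : (a %% p ^ i.+1 < p ^ i.+1)%N by rewrite ltn_mod.
  rewrite (bigD1 (Ordinal ha)) //= modn_mod eqxx mul1r (expr_mod _ z1).
  rewrite big1 ?addr0 // => c ne; case: eqP => [h|_]; last by rewrite mul0r.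
  by case/eqP: ne; apply: val_inj; rewrite /= h modn_small.
by rewrite -big_split; apply: eq_bigr => c _; rewrite natrD mulrDl.
Qed.

Lemma equi_sum0 A : equi A i -> \sum_(a <- A) z ^+ a = 0.
Proof.
move=> eqA; rewrite sum_cnt big1 // => r _.
rewrite (eq_bigr (fun k : 'I_p => (cnt A i.+1 r)%:R * z ^+ r * z ^+ (k * p ^ i))).
  rewrite -mulr_sumr (_ : \sum_k _ = (cyclo_pp p i F).[z]); last first.
    by rewrite /cyclo_pp horner_sum; apply: eq_bigr => k _; rewrite hornerXn.
  by rewrite (rootP (root_cyclo_pp z1 zn1)) mulr0.
by move=> k _; rewrite equi_child // exprD mulrA.
Qed.

(** The polynomial r of residue counts modulo P = p^(i+1) vanishes at z, so it is Q times the
    cyclotomic polynomial with deg Q < q = p^i. Its coefficients are therefore q-periodic, which is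
    equidistribution. *)
Lemma sum0_equi A : \sum_(a <- A) z ^+ a = 0 -> equi A i.
Proof.
pose q := (p ^ i)%N; pose P := (p ^ i.+1)%N.
have EP : (P = p * q)%N by rewrite /P expnS.
have q0 : (0 < q)%N := pX0 i.
move=> S0; pose r : {poly rat} := \poly_(c < P) (cnt A i.+1 c)%:R.
have rc c : (c < P)%N -> r`_c = (cnt A i.+1 c)%:R by move=> cP; rewrite coef_poly cP.
have r0 c : (P <= c)%N -> r`_c = 0 by move=> cP; rewrite coef_poly ltnNge cP.
have rz : root (map_poly ratr r) z.
  apply/rootP; rewrite -S0 (@horner_coef_wide _ P); last first.
    by rewrite size_map_poly size_poly.
  rewrite sum_cnt_mod; apply: eq_bigr => c _.
  by rewrite coef_map /= rc // ratr_nat.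
have /dvdpP [Q EQ] : cyclo_pp p i rat %| r by apply: cyclo_pp_dvd rz.
have Qs : (size Q <= q)%N.
  have [->|Qn0] := eqVneq Q 0; first by rewrite size_poly0.
  have c0 : cyclo_pp p i rat != 0 by rewrite -size_poly_eq0 size_cyclo_pp.
  have := size_poly P (fun c => (cnt A i.+1 c)%:R : rat); rewrite -/r EQ size_mul //.
  rewrite size_cyclo_pp // totient_pfactor //= -/q EP.
  by move: (size Q) => s; nia.
have Q0 c : (q <= c)%N -> Q`_c = 0 by move=> qc; apply: nth_default; apply: leq_trans qc.
(* Coefficient c of r * (X^q - 1) = Q * (X^P - 1). The right side vanishes for q <= c < P; the index
   c + q that wraps past P is settled by comparing two instances. *)
have key c : (if (c < q)%N then 0 else r`_(c - q)) - r`_c =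
             (if (c < P)%N then 0 else Q`_(c - P)) - Q`_c.
  have := congr1 (fun f : {poly rat} => f`_c) (congr1 (fun f => f * ('X^q - 1)) EQ).
  by rewrite -mulrA [cyclo_pp _ _ _ * _]mulrC cyclo_pp_mul !mulrBr !mulr1 !coefB !coefMXn.
have Pq : (q < P)%N by rewrite EP; nia.
move=> c; rewrite (@cnt_mod _ _ (c + q) (c %% P + q)); last by rewrite modnDml.
rewrite -(@cnt_mod A i.+1 (c %% P) c); last by rewrite modn_mod.
have : (c %% P < P)%N by rewrite ltn_mod pX0.
move: (c %% P)%N => b bP; apply/eqP; rewrite -(eqr_nat rat).
have [lt|ge] := ltnP (b + q) P.
  have := key (b + q)%N; rewrite lt addnK ltnNge leq_addl /= (Q0 (b + q)%N) ?leq_addl //.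
  by rewrite !rc // subr0 => /eqP; rewrite subr_eq0 eq_sym.
have Eb : (b + q = (b + q - P) + P)%N by rewrite subnK.
rewrite (@cnt_mod _ _ (b + q) (b + q - P)); last by rewrite {1}Eb modnDr.
have lq : (b + q - P < q)%N by lia.
have := key (b + q)%N; have := key (b + q - P)%N.
have lP : (b + q - P < P)%N by apply: ltn_trans Pq.
rewrite lq lP !sub0r => /oppr_inj.
rewrite ltnNge leq_addl /= ltnNge ge /= addnK (r0 (b + q)%N) // (Q0 (b + q)%N) ?leq_addl //.
by rewrite !subr0 => <-; rewrite !rc // => ->.
Qed.

End CharacterSums.

(** * Tilings of the cyclic group Z/p^d *)

Lemma sum_allpairs_exp (F : comNzRingType) (z : F) A T :
  (\sum_(a <- A) z ^+ a) * (\sum_(t <- T) z ^+ t) =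
  \sum_(g <- [seq (a + t)%N | a <- A, t <- T]) z ^+ g.
Proof.
rewrite big_flatten big_map mulr_suml; apply: eq_bigr => a _.
by rewrite big_map mulr_sumr; apply: eq_bigr => t _; rewrite exprD.
Qed.

Definition tiles A T d :=
  perm_eq [seq (a + t) %% p ^ d | a <- A, t <- T]%N (iota 0 (p ^ d)).

Lemma hom_size A J d : hom A J d -> A != [::] -> size A = (p ^ lev J 0 d)%N.
Proof.
case: A => // a A hA _; rewrite -(cnt0 _ a).
by apply: hom_full hA _ _; rewrite ?mem_head.
Qed.

(** At a root of unity of order p^(i+1) the transforms of A and T multiply to the full geometric
    sum, which is zero. For i outside J that of A is nonzero, so T is equidistributed at i; its size
    is p^d / #A. *)
Lemma tiles_hom A T J d : hom A J d -> tiles A T d -> hom T (predC J) d.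
Proof.
move=> hA til.
have sAT : (size A * size T = p ^ d)%N.
  by rewrite -(@size_allpairs _ _ _ (fun a t => (a + t) %% p ^ d)%N) (perm_size til) size_iota.
have An : A != [::] by apply/eqP => A0; move: sAT (pX0 d); rewrite A0 mul0n => <-.
apply: equi_hom => [i id /= nJ|]; last first.
  have := levC J 0 d; rewrite subn0 => h; move: sAT.
  by rewrite (hom_size hA An) -{2}h expnD => /eqP; rewrite eqn_pmul2l // => /eqP.
have [z prz] := C_prim_root_exists (pX0 i.+1).
have z1 := prim_expr_order prz.
have zn1 : z ^+ (p ^ i) != 1.
  rewrite -(prim_order_dvd prz); apply/negP => /dvdn_leq; rewrite pX0 => /(_ isT).
  by rewrite leqNgt ltn_exp2l // ltnSn.
have zd : z ^+ (p ^ d) = 1.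
  by rewrite -(subnK id) expnD mulnC exprM z1 expr1n.
have : (\sum_(a <- A) z ^+ a) * (\sum_(t <- T) z ^+ t) = 0.
  rewrite sum_allpairs_exp.
  transitivity (\sum_(g <- iota 0 (p ^ d)) z ^+ g).
    rewrite -(perm_big _ til) !big_flatten !big_map; apply: eq_bigr => a _.
    by rewrite !big_map; apply: eq_bigr => t _; rewrite (expr_mod _ zd).
  have : (z - 1) * \sum_(g <- iota 0 (p ^ d)) z ^+ g = 0.
    rewrite (_ : iota 0 (p ^ d) = index_iota 0 (p ^ d)); last by rewrite /index_iota subn0.
    by rewrite big_mkord -subrX1 zd subrr.
  move/eqP; rewrite mulf_eq0 => /orP [|/eqP //]; rewrite subr_eq0 => /eqP zE.
  by move: zn1; rewrite zE expr1n eqxx.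
move/eqP; rewrite mulf_eq0 => /orP [] /eqP /(sum0_equi z1 zn1) // eqA.
case: A An hA eqA {sAT til} => // a A _ hA.
by move/(hom_not_equi hA (mem_head a A) id nJ).
Qed.

(** If a + t = b + s with a different from b, then a, b and t, s split at the same level, which
    would be both in J and outside it. So the sums are distinct, and there are p^d of them. *)
Lemma hom_tiles A T J d : hom A J d -> hom T (predC J) d -> A != [::] -> T != [::] ->
  uniq A -> uniq T -> {in A, forall a, a < p ^ d}%N -> {in T, forall t, t < p ^ d}%N ->
  tiles A T d.
Proof.
move=> hA hT An Tn uA uT ltA ltT.
have inj : {in [seq (a, t) | a <- A, t <- T] &, injective (fun x => (x.1 + x.2) %% p ^ d)%N}.
  move=> _ _ /allpairsP [[a t] /= [aA tT ->]] /allpairsP [[b s] /= [bA sT ->]] /= E.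
  have [ab|/eqP ab] := eqVneq a b.
    move: E; rewrite ab => /eqP; rewrite eqn_modDl !modn_small ?ltT // => /eqP -> //.
  have [|i id [h1 h2]] := @split_level a b d; first by rewrite !modn_small ?ltA.
  have Ji := hom_level hA aA bA id h1 h2.
  suff : predC J i by rewrite /= Ji.
  have addI j : (j <= d)%N -> a + t = b + s %[mod p ^ j] by move=> jd; apply: eq_modX jd E.
  apply: (hom_level hT tT sT id).
    have := addI i (ltnW id); rewrite -modnDml h1 modnDml => /eqP.
    by rewrite eqn_modDl => /eqP.
  move=> ts; apply: h2; have := addI i.+1 id.
  by rewrite -modnDmr ts modnDmr => /eqP; rewrite eqn_modDr => /eqP.
rewrite /tiles.
have -> : [seq (a + t) %% p ^ d | a <- A, t <- T]%N =
  [seq (x.1 + x.2) %% p ^ d | x <- [seq (a, t) | a <- A, t <- T]]%N.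
  by rewrite map_allpairs.
have us : uniq [seq (x.1 + x.2) %% p ^ d | x <- [seq (a, t) | a <- A, t <- T]]%N.
  by rewrite map_inj_in_uniq // allpairs_uniq // => -[? ?] [? ?] _ _ [-> ->].
apply: uniq_perm; rewrite ?iota_uniq //.
have [] // := uniq_min_size us (s2 := iota 0 (p ^ d)).
  by move=> _ /mapP [x _ ->]; rewrite mem_iota /= add0n ltn_mod.
rewrite size_iota size_map size_allpairs (hom_size hA An) (hom_size hT Tn).
by rewrite -expnD levC subn0.
Qed.

End Trees.

(** * Arithmetic of truncations *)

Section PadicArithmetic.
Variables (p : nat) (hp : prime p).
Implicit Types (k m n i j : int) (r s : rat) (x y : Qp p).

Let p0 : (0 < p)%N := prime_gt0 hp.
Let pX0 (i : nat) : (0 < p ^ i)%N. Proof. by rewrite expn_gt0 p0. Qed.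

Lemma pw_gt0 k : 0 < pw p k.
Proof. by rewrite exprz_gt0 // ltr0n. Qed.

Lemma pw_neq0 k : pw p k != 0.
Proof. by rewrite gt_eqF // pw_gt0. Qed.

Lemma pwD a b : pw p (a + b) = pw p a * pw p b.
Proof. by rewrite /pw expfzDr // pnatr_eq0 -lt0n. Qed.

Lemma pw_nat (n : nat) : pw p n%:Z = (p ^ n)%:R.
Proof. by rewrite /pw -exprnP natrX. Qed.

Lemma pw0 : pw p 0 = 1.
Proof. by rewrite /pw expr0z. Qed.

(** Membership in p^k Z. Truncations lie in Z[1/p], where this coincides with congruence to zero
    modulo p^k Z_p. *)
Definition pz k r : bool := r / pw p k \is a Num.int.

Lemma pzP k r : reflect (exists z : int, r = pw p k * z%:~R) (pz k r).
Proof.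
apply: (iffP intrP) => -[z Ez]; exists z.
  by rewrite -Ez mulrC divfK // pw_neq0.
by rewrite Ez mulrC mulKf // pw_neq0.
Qed.

Lemma pz_zero k : pz k 0.
Proof. by rewrite /pz mul0r rpred0. Qed.

Lemma pzD k r s : pz k r -> pz k s -> pz k (r + s).
Proof. by rewrite /pz mulrDl; apply: rpredD. Qed.

Lemma pzN k r : pz k (- r) = pz k r.
Proof. by rewrite /pz mulNr rpredN. Qed.

Lemma pzB k r s : pz k r -> pz k s -> pz k (r - s).
Proof. by move=> hr hs; rewrite pzD ?pzN. Qed.

Lemma pzBC k r s : pz k (r - s) = pz k (s - r).
Proof. by rewrite -pzN opprB. Qed.

Lemma pz_trans k s r t : pz k (r - s) -> pz k (s - t) -> pz k (r - t).
Proof. by move=> h1 h2; have := pzD h1 h2; rewrite addrA subrK. Qed.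

Lemma pzM a b r s : pz a r -> pz b s -> pz (a + b) (r * s).
Proof. by rewrite /pz pwD invfM mulrACA; apply: rpredM. Qed.

Lemma pz_pw k (z : int) : pz k (pw p k * z%:~R).
Proof. by apply/pzP; exists z. Qed.

Lemma pz_pw_nat k (c : nat) : pz k (pw p k * c%:R).
Proof. exact: (pz_pw k c%:Z). Qed.

Lemma pz_le k m r : k <= m -> pz m r -> pz k r.
Proof.
move=> km /pzP [z ->]; apply/pzP; exists ((p ^ `|m - k|)%N%:Z * z).
have E : m = k + `|m - k|%N%:Z by rewrite gez0_abs; lia.
by rewrite {1}E pwD pw_nat rmorphM /= -mulrA.
Qed.

Lemma pmod_pz r k : pz k (r - pmod p r k).
Proof. by rewrite /pmod opprB addrC subrK pz_pw. Qed.

Lemma pmod_bounds r k : 0 <= pmod p r k < pw p k.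
Proof.
have E : r = pw p k * (r / pw p k) by rewrite mulrC divfK // pw_neq0.
rewrite /pmod {1 3}E -mulrBr; have /andP [h1 h2] := floor_itv (r / pw p k).
rewrite intrD in h2.
rewrite pmulr_rge0 ?pw_gt0 // subr_ge0 h1 /= -[ltRHS]mulr1 ltr_pM2l ?pw_gt0 //.
by rewrite ltrBlDl.
Qed.

Lemma eq_pmodP r s k : reflect (pmod p r k = pmod p s k) (pz k (r - s)).
Proof.
apply: (iffP idP) => [/pzP [z Ez]|E].
  have -> : r = s + pw p k * z%:~R by rewrite -Ez addrC subrK.
  rewrite /pmod mulrDl [_ * _ / _]mulrC mulKf ?pw_neq0 //.
  by rewrite floorDrz ?intr_int // intrKfloor intrD mulrDr opprD addrACA subrr addr0.
apply: pz_trans (pmod_pz r k) _; rewrite E pzBC; exact: pmod_pz.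
Qed.

Lemma pmod_id r k : 0 <= r < pw p k -> pmod p r k = r.
Proof.
move=> /andP [r0 rk]; rewrite /pmod.
have -> : Num.floor (r / pw p k) = 0.
  apply: floor_def; apply/andP; split; first by apply: divr_ge0 => //; apply/ltW/pw_gt0.
  by rewrite ltr_pdivrMr ?pw_gt0 // mul1r.
by rewrite mulr0 subr0.
Qed.

Lemma pmod0 k : pmod p 0 k = 0.
Proof. by rewrite pmod_id // lexx pw_gt0. Qed.

Lemma pmod_eq0 r k : (pmod p r k = 0) <-> pz k r.
Proof.
split => h; first by have := pmod_pz r k; rewrite h subr0.
by rewrite -(pmod0 k); apply/eq_pmodP; rewrite subr0.
Qed.

Lemma pmod_pmod r k m : k <= m -> pmod p (pmod p r m) k = pmod p r k.
Proof. by move=> km; apply/eq_pmodP; rewrite pzBC; apply: pz_le km (pmod_pz r m). Qed.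

Lemma pmod_pw_nat n (c i : nat) :
  pmod p (pw p n * c%:R) (n + i%:Z) = pw p n * (c %% p ^ i)%:R.
Proof.
rewrite -[RHS](@pmod_id _ (n + i%:Z)); last first.
  rewrite mulr_ge0 ?ler0n ?ltW ?pw_gt0 //= pwD ltr_pM2l ?pw_gt0 // pw_nat.
  by rewrite ltr_nat ltn_mod.
apply/eq_pmodP; rewrite -mulrBr {1}(divn_eq c (p ^ i)) natrD addrK natrM.
by rewrite mulrCA -pw_nat -pwD mulrC pz_pw_nat.
Qed.

Lemma Qp_inj x y : (forall k, tr x k = tr y k) -> x = y.
Proof. by move=> h; apply: val_inj; apply/funext. Qed.

Lemma tr_pmod x k m : k <= m -> tr x k = pmod p (tr x m) k.
Proof.
have /asboolP [coh _] := tr_valid x.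
move=> km; have -> : m = k + `|m - k|%N%:Z by rewrite gez0_abs; lia.
elim: `|m - k|%N => [|d IH].
  by rewrite addr0 pmod_id // coh pmod_bounds.
by rewrite IH coh pmod_pmod; [congr pmod; congr tr; lia|lia].
Qed.

Lemma tr_bounds x k : 0 <= tr x k < pw p k.
Proof. by rewrite (tr_pmod x (lexx k)) pmod_bounds. Qed.

Lemma tr_cong x k m m' : k <= m -> k <= m' -> pz k (tr x m - tr x m').
Proof. by move=> h h'; apply/eq_pmodP; rewrite -!tr_pmod. Qed.

Lemma tr_low x : exists N, tr x N = 0.
Proof. by have /asboolP [_ [N h]] := tr_valid x; exists N; apply: h. Qed.

Lemma tr0_le x k m : k <= m -> tr x m = 0 -> tr x k = 0.
Proof. by move=> km h; rewrite (tr_pmod x km) h pmod0. Qed.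

Lemma tr_pz x a k : tr x a = 0 -> pz a (tr x k).
Proof.
move=> h; have [ka|ak] := lerP k a; first by rewrite (tr0_le ka h) pz_zero.
by apply/pmod_eq0; rewrite -tr_pmod // ltW.
Qed.

Lemma tr_eq x y k m m' : k <= m -> k <= m' -> tr x k = tr y k <-> pz k (tr x m - tr y m').
Proof.
move=> h h'; rewrite (tr_pmod x h) (tr_pmod y h').
by split=> [E|E]; [apply/eq_pmodP|apply/eq_pmodP].
Qed.

Lemma tr_eq_le x y k m : k <= m -> tr x m = tr y m -> tr x k = tr y k.
Proof. by move=> km E; rewrite (tr_pmod x km) (tr_pmod y km) E. Qed.

Lemma qp_valid_pmod (f : int -> rat) (N : int) :
  (forall k, pz k (f k - f (k + 1))) -> (forall k, k <= N -> pz k (f k)) ->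
  `[< qp_valid p (fun k => pmod p (f k) k) >].
Proof.
move=> coh low; apply/asboolP; split => [k|].
  rewrite pmod_pmod; last lia.
  exact/eq_pmodP.
by exists N => k kN; apply/pmod_eq0; apply: low.
Qed.

Definition of_rat r : Qp p := insubd (qp0 p) (fun k => pmod p r k).

Lemma tr_of_rat N r k : pz N r -> tr (of_rat r) k = pmod p r k.
Proof.
move=> hr; have v : `[< qp_valid p (fun k => pmod p r k) >].
  apply: (@qp_valid_pmod (fun=> r) N) => m; first by rewrite subrr pz_zero.
  by move=> mN; apply: pz_le hr.
by rewrite /of_rat -[tr _]/(val _) insubdK.
Qed.

Lemma subrBB (a b c d : rat) : a - b - (c - d) = (a - c) - (b - d).
Proof. ring. Qed.

Lemma tr_sub x y k : tr (qsub x y) k = pmod p (tr x k - tr y k) k.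
Proof.
have [a ha] := tr_low x; have [b hb] := tr_low y.
have v : `[< qp_valid p (fun k => pmod p (tr x k - tr y k) k) >].
  apply: (@qp_valid_pmod (fun k => tr x k - tr y k) (Num.min a b)) => m.
    rewrite subrBB; apply: pzB; apply: tr_cong; lia.
  rewrite le_min => /andP [ma mb].
  by rewrite (tr0_le ma ha) (tr0_le mb hb) subrr pz_zero.
by rewrite /qsub -[tr _]/(val _) insubdK.
Qed.

Lemma tr_sub_pz x y k m m' : k <= m -> k <= m' ->
  pz k (tr (qsub x y) m - (tr x m' - tr y m')).
Proof.
move=> km km'; apply: (@pz_trans _ (tr x m - tr y m)).
  by rewrite tr_sub pzBC; apply: pz_le km (pmod_pz _ _).
by rewrite subrBB; apply: pzB; apply: tr_cong.
Qed.

Lemma tr_sub_eq0 x y k : tr (qsub x y) k = 0 <-> tr x k = tr y k.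
Proof. by rewrite tr_sub pmod_eq0 -tr_eq. Qed.

Lemma prod_cong x y a b k m m' n n' : tr x a = 0 -> tr y b = 0 ->
  k - b <= m -> k - b <= m' -> k - a <= n -> k - a <= n' ->
  pz k (tr x m * tr y n - tr x m' * tr y n').
Proof.
move=> xa yb hm hm' hn hn'.
have -> : tr x m * tr y n - tr x m' * tr y n' =
    (tr x m - tr x m') * tr y n + tr x m' * (tr y n - tr y n') by ring.
apply: pzD; first by rewrite -[k](subrK b) pzM ?tr_cong ?tr_pz.
by rewrite -[k](subrK a) addrC pzM ?tr_cong ?tr_pz.
Qed.

(** The valuation bounds a of x and b of y say which precision of each factor fixes the product
    modulo p^k, replacing the eventual value in [qmul] by one explicit product. *)
Lemma tr_mul x y a b k m n : tr x a = 0 -> tr y b = 0 -> k - b <= m -> k - a <= n ->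
  tr (qmul x y) k = pmod p (tr x m * tr y n) k.
Proof.
move=> xa yb hm hn; pose M j := Num.max (j - a) (j - b).
have Ma j : j - a <= M j by rewrite le_max lexx.
have Mb j : j - b <= M j by rewrite le_max lexx orbT.
pose f j := tr x (M j) * tr y (M j).
have E j : xget 0 [set r : rat | exists M0 : int,
     forall M : int, M0 <= M -> pmod p (tr x M * tr y M) j = r] = pmod p (f j) j.
  apply: xget_subset1.
    exists (M j) => N hN; apply/eq_pmodP; apply: (prod_cong xa yb) => //.
      exact: le_trans (Mb j) hN.
    exact: le_trans (Ma j) hN.
  move=> r s /= [M0 h] [M1 h']; rewrite -(h (Num.max M0 M1)) ?le_max ?lexx //.
  by rewrite (h' (Num.max M0 M1)) // le_max lexx orbT.
have v : `[< qp_valid p (fun k => pmod p (f k) k) >].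
  apply: (@qp_valid_pmod f (a + b)) => j.
    by apply: (prod_cong xa yb); rewrite ?Ma ?Mb //;
      [apply: le_trans (Mb (j + 1))|apply: le_trans (Ma (j + 1))]; lia.
  by move=> jab; apply: pz_le jab _; rewrite pzM ?tr_pz.
rewrite /qmul -[tr _]/(val _) (_ : (fun k => _) = (fun k => pmod p (f k) k)); last first.
  by apply/funext => j; rewrite E.
rewrite insubdK //; apply/eq_pmodP; exact: (prod_cong xa yb).
Qed.

Lemma vp_subE x y i : vp_is (qsub x y) i <-> tr x i = tr y i /\ tr x (i + 1) <> tr y (i + 1).
Proof.
by rewrite /vp_is; split=> -[h1 h2]; split; try exact/tr_sub_eq0; move=> /tr_sub_eq0.
Qed.

Lemma tr_common_low x y N : exists n, [/\ n <= N, tr x n = 0 & tr y n = 0].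
Proof.
have [a ha] := tr_low x; have [b hb] := tr_low y.
exists (Num.min N (Num.min a b)); split; first by rewrite ge_min lexx.
  by apply: tr0_le ha; rewrite !ge_min lexx orbT.
by apply: tr0_le hb; rewrite !ge_min lexx !orbT.
Qed.

Lemma tr_split x y k : tr x k <> tr y k -> exists2 i, i < k & vp_is (qsub x y) i.
Proof.
move=> h; have [n [nk xn yn]] := tr_common_low x y k.
have Ek : k = n + `|k - n|%N%:Z by rewrite gez0_abs; lia.
move: h; rewrite Ek; elim: `|k - n|%N => [|d IH] h; first by rewrite addr0 xn yn in h.
have [E|/eqP/IH [i id vi]] := eqVneq (tr x (n + d%:Z)) (tr y (n + d%:Z)).
  exists (n + d%:Z); first lia.
  apply/vp_subE; split=> //; rewrite (_ : n + d%:Z + 1 = n + d.+1%:Z) //; lia.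
by exists i => //; lia.
Qed.

Lemma neq_split x y : x <> y -> exists i, vp_is (qsub x y) i.
Proof.
move=> xy; have /existsNP [k h] : ~ (forall k, tr x k = tr y k) by move/Qp_inj.
by have [i _] := tr_split h; exists i.
Qed.

Lemma vp_diff x y i m : vp_is (qsub x y) i -> i < m ->
  exists2 u : int, tr x m - tr y m = pw p i * u%:~R & ~~ (p %| u)%Z.
Proof.
move=> /vp_subE [h1 h2] im.
have /pzP [u Eu] : pz i (tr x m - tr y m) by rewrite -tr_eq // ltW.
exists u => //; apply/negP => /dvdzP [w Ew]; apply: h2.
apply/(@tr_eq _ _ _ m m); [lia|lia|].
rewrite Eu Ew rmorphM /= mulrCA mulrC -[pw p i * p%:~R]/(_ * (pw p 1)) -pwD.
exact: pz_pw.
Qed.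

(** The residue of p^(-n) x modulo p^d. For x in p^n Z_p the quotient is already a natural number,
    so floor and absolute value only change the type ([codeE]). *)
Definition code x n (d : nat) : nat := `|Num.floor (tr x (n + d%:Z) / pw p n)|%N.

Lemma codeE x n (d : nat) : tr x n = 0 -> tr x (n + d%:Z) = pw p n * (code x n d)%:R.
Proof.
move=> xn; have /pzP [z Ez] := tr_pz (n + d%:Z) xn.
have := tr_bounds x (n + d%:Z); rewrite /code Ez mulrC mulfK ?pw_neq0 //.
rewrite intrKfloor => /andP [h _]; rewrite mulrC; congr (_ * _).
have z0 : 0 <= z by move: h; rewrite pmulr_lge0 ?pw_gt0 // ler0z.
by rewrite -[in LHS](gez0_abs z0).
Qed.

Lemma code_lt x n (d : nat) : tr x n = 0 -> (code x n d < p ^ d)%N.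
Proof.
move=> xn; have /andP [_] := tr_bounds x (n + d%:Z); rewrite (codeE d xn).
by rewrite pwD ltr_pM2l ?pw_gt0 // pw_nat ltr_nat.
Qed.

Lemma code_mod x n (i d : nat) : tr x n = 0 -> (i <= d)%N ->
  tr x (n + i%:Z) = pw p n * (code x n d %% p ^ i)%:R.
Proof.
move=> xn id; rewrite (@tr_pmod _ _ (n + d%:Z)); last lia.
by rewrite codeE // pmod_pw_nat.
Qed.

Lemma code_eq x y n (i d : nat) : tr x n = 0 -> tr y n = 0 -> (i <= d)%N ->
  tr x (n + i%:Z) = tr y (n + i%:Z) <-> code x n d = code y n d %[mod p ^ i].
Proof.
move=> xn yn id; rewrite !(@code_mod _ _ _ d) //; split=> [|->//].
by move/(mulfI (pw_neq0 n))/eqP; rewrite eqr_nat => /eqP.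
Qed.

Lemma code_inj x y n (d : nat) : tr x n = 0 -> tr y n = 0 ->
  tr x (n + d%:Z) = tr y (n + d%:Z) <-> code x n d = code y n d.
Proof. by move=> xn yn; rewrite (@code_eq _ _ _ d d) // !modn_small ?code_lt. Qed.

Definition rep n (c : nat) : Qp p := of_rat (pw p n * c%:R).

Lemma tr_rep n c k : tr (rep n c) k = pmod p (pw p n * c%:R) k.
Proof. by rewrite /rep (@tr_of_rat n) // pz_pw_nat. Qed.

Lemma tr_rep_low n c : tr (rep n c) n = 0.
Proof. by rewrite tr_rep; apply/pmod_eq0; apply: pz_pw_nat. Qed.

Lemma tr_rep_nat n (c i : nat) : tr (rep n c) (n + i%:Z) = pw p n * (c %% p ^ i)%:R.
Proof. by rewrite tr_rep pmod_pw_nat. Qed.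

Lemma code_rep n (c d : nat) : (c < p ^ d)%N -> code (rep n c) n d = c.
Proof.
move=> cd; have := codeE d (tr_rep_low n c); rewrite tr_rep_nat modn_small //.
by move/(mulfI (pw_neq0 n))/eqP; rewrite eqr_nat => /eqP.
Qed.

Lemma code_sub x t n (d : nat) : tr x n = 0 -> tr t n = 0 ->
  code (qsub x t) n d + code t n d = code x n d %[mod p ^ d].
Proof.
move=> xn tn; have sn : tr (qsub x t) n = 0 by apply/tr_sub_eq0; rewrite xn tn.
have : pz (n + d%:Z) (tr (qsub x t) (n + d%:Z) - (tr x (n + d%:Z) - tr t (n + d%:Z))).
  exact: tr_sub_pz.
rewrite !codeE // opprB addrA -mulrDr -natrD => /eq_pmodP.
rewrite !pmod_pw_nat => /(mulfI (pw_neq0 n))/eqP.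
by rewrite eqr_nat => /eqP.
Qed.

(* The residues modulo p^d of p^(-n) x, for x in E and p^n Z_p. *)
Definition codes (E : set (Qp p)) n (d : nat) : seq nat :=
  [seq k <- iota 0 (p ^ d) | `[< exists x, [/\ E x, tr x n = 0 & code x n d = k] >]].

Lemma codes_uniq E n d : uniq (codes E n d).
Proof. by rewrite filter_uniq ?iota_uniq. Qed.

Lemma mem_codes E n d (k : nat) :
  k \in codes E n d <-> exists x, [/\ E x, tr x n = 0 & code x n d = k].
Proof.
rewrite mem_filter mem_iota /=; split => [/andP [/asboolP //]|h].
apply/andP; split; first exact/asboolP.
by case: h => x [_ xn <-]; rewrite add0n code_lt.
Qed.

Lemma codes_lt E n d : {in codes E n d, forall k : nat, k < p ^ d}%N.
Proof. by move=> k; rewrite mem_filter mem_iota => /andP [_]. Qed.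

End PadicArithmetic.

(** * Homogeneous subsets of Q_p *)

Section Cardinals.
Local Open Scope card_scope.

Lemma card_seq (T : eqType) (s : seq T) : uniq s -> [set` s] #= `I_(size s).
Proof.
case: s => [|t0 s]; first by rewrite set_nil II0.
set s' := t0 :: s => us.
have -> : [set` s'] = nth t0 s' @` `I_(size s').
  apply/seteqP; split => x /=.
    by move=> xs; exists (index x s'); [move: xs; rewrite -index_mem|exact: nth_index].
  by move=> [j jl <-]; rewrite mem_nth.
apply: inj_card_eq => i j /set_mem /= il /set_mem /= jl /eqP.
by rewrite nth_uniq // => /eqP.
Qed.

Lemma card_II_inj (T : Type) (A : set T) (a b : nat) : A #= `I_a -> A #= `I_b -> a = b.
Proof.
by move=> ha hb; apply/card_eq_II; apply: card_eq_trans hb; rewrite card_eq_sym.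
Qed.

End Cardinals.

Section Homogeneous.
Local Open Scope card_scope.
Variables (p : nat) (hp : prime p).
Implicit Types (k m n i j : int) (r s : rat) (x y : Qp p) (E O : set (Qp p)).

Let p0 : (0 < p)%N := prime_gt0 hp.
Let pX0 (i : nat) : (0 < p ^ i)%N. Proof. by rewrite expn_gt0 p0. Qed.

(** Level l of the residue tree of p^n Z_p stands for valuation n + l. *)
Definition levset (I : set int) n : pred nat := fun l => `[< I (n + l%:Z) >].

Lemma BE (a : Qp p) n : B a (- n) = [set x | tr x n = tr a n].
Proof. by rewrite /B opprK. Qed.

Lemma card_codes E n (d i : nat) (a : Qp p) :
  (forall x y, E x -> E y -> tr x n = 0 -> tr y n = 0 ->
     tr x (n + d%:Z) = tr y (n + d%:Z) -> x = y) ->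
  tr a n = 0 -> (i <= d)%N ->
  E `&` B a (- (n + i%:Z)) #= `I_(cnt p (codes E n d) i (code a n d)).
Proof.
move=> sep an id.
have low x : tr x (n + i%:Z) = tr a (n + i%:Z) -> tr x n = 0.
  by move=> h; rewrite -an; apply: tr_eq_le h; lia.
rewrite /cnt -size_filter.
apply: card_eq_trans (card_seq (filter_uniq _ (codes_uniq _ _ _))).
rewrite (_ : [set` _] = (fun x => code x n d) @` (E `&` B a (- (n + i%:Z)))).
  rewrite card_eq_sym; apply: inj_card_eq; rewrite BE.
  move=> x y /set_mem [Ex /= xa] /set_mem [Ey /= ya] /= Exy.
  by apply: sep => //; rewrite ?low //; apply/code_inj; rewrite ?low.
apply/seteqP; split => k /=.
  rewrite mem_filter => /andP [/eqP ka /mem_codes [//|x [Ex xn xk]]].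
  exists x => //; split => //; rewrite BE /=; apply/(@code_eq _ hp _ _ _ _ d) => //.
  by rewrite xk.
move=> [x [Ex]]; rewrite BE /= => xa <-; rewrite mem_filter; apply/andP; split.
  by apply/eqP/code_eq; rewrite ?low.
by apply/mem_codes => //; exists x; rewrite low.
Qed.

Lemma card_levset (I : set int) n (i d : nat) : (forall j, I j -> j < n + d%:Z) ->
  [set j | I j /\ n + i%:Z <= j] #= `I_(lev (levset I n) i d).
Proof.
move=> ID; rewrite /lev -size_filter.
apply: card_eq_trans (card_seq (filter_uniq _ (iota_uniq _ _))).
rewrite (_ : [set j | _] = (fun l : nat => n + l%:Z) @`
    [set` [seq l <- index_iota i d | levset I n l]]).
  by apply: inj_card_eq => a b _ _ /=; lia.
apply/seteqP; split => j /=.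
  move=> [Ij ij]; exists `|j - n|%N.
    rewrite /= mem_filter mem_index_iota /levset.
    have := ID j Ij => jd.
    rewrite (_ : n + _ = j); last by rewrite gez0_abs; lia.
    by apply/andP; split; [exact/asboolP|lia].
  by rewrite gez0_abs; lia.
move=> [l]; rewrite mem_filter mem_index_iota => /andP [/asboolP Il /andP [il _]] <-.
by split=> //; lia.
Qed.

Lemma cnt_top A (d c : nat) : uniq A -> {in A, forall a : nat, a < p ^ d}%N ->
  (cnt p A d c <= 1)%N.
Proof.
move=> uA ltA; rewrite /cnt (eq_in_count (a2 := pred1 (c %% p ^ d)%N)).
  by rewrite count_uniq_mem // leq_b1.
by move=> a /ltA la /=; rewrite (modn_small la).
Qed.

Lemma phd_codes E D : p_homogeneous_discrete E ->
  (forall i, adm_orders E i -> i < D) ->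
  (forall x y, E x -> E y -> tr x D = tr y D -> x = y) /\
  (forall n (d : nat), n + d%:Z = D -> hom p (codes E n d) (levset (adm_orders E) n) d).
Proof.
move=> [_ hE] hD.
have sep x y : E x -> E y -> tr x D = tr y D -> x = y.
  move=> Ex Ey xy; apply: contrapT => nxy.
  have [i vi] := neq_split hp nxy; have iD : i < D by apply: hD; exists x, y.
  have [_ +] := (vp_subE hp x y i).1 vi; apply.
  by apply: (tr_eq_le hp _ xy); lia.
split=> // n d Ed i c id.
have := @card_codes E n d i (rep p n (c %% p ^ d)) _ (tr_rep_low hp _ _) id.
rewrite code_rep ?ltn_mod // Ed.
rewrite (@cnt_mod p _ _ (c %% p ^ d) c); last first.
  by rewrite modn_dvdm // dvdn_exp2l.
move=> /(_ (fun x y Ex Ey _ _ => sep x y Ex Ey)) hc.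
case: (hE (n + i%:Z) (rep p n (c %% p ^ d))) => [E0|[k [hk hEk]]].
  left; apply: card_II_inj hc _; by rewrite II0 card_eq0 E0.
right; rewrite (card_II_inj hc hEk); congr (_ ^ _)%N.
apply: card_II_inj hk _; apply: card_levset => j; rewrite Ed; exact: hD.
Qed.

(** Windows starting at arbitrarily low n suffice, because any two points and any ball centre lie in
    some p^n Z_p. Nonemptiness is what lets every order of [I] be realised by a pair of points. *)
Lemma codes_phd E (I : set int) D n0 : (forall i, I i -> i < D) ->
  (forall x y, E x -> E y -> tr x D = tr y D -> x = y) ->
  (forall n (d : nat), n <= n0 -> n + d%:Z = D ->
     hom p (codes E n d) (levset I n) d /\ codes E n d != [::]) ->
  p_homogeneous_discrete E /\ adm_orders E = I.
Proof.
move=> ID sep hE.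
have le_level n i (d : nat) : n <= i -> n + d%:Z = D -> i < D ->
    exists2 l, (l < d)%N & i = n + l%:Z.
  by move=> ni nd iD; exists `|i - n|%N; lia.
have EI : adm_orders E = I.
  apply/seteqP; split => i.
    move=> [x [y [Ex [Ey [xy /(vp_subE hp) [h1 h2]]]]]].
    have iD : i < D.
      rewrite ltNge; apply/negP => Di; apply: xy; apply: sep => //.
      exact: (tr_eq_le hp Di h1).
    have [n [nn xn yn]] := tr_common_low hp x y (Num.min n0 i).
    move: nn; rewrite le_min => /andP [nn ni].
    have Ed : n + `|D - n|%N%:Z = D by lia.
    have [l ld El] := le_level n i _ ni Ed iD.
    have [hn _] := hE n _ nn Ed.
    suff : levset I n l by rewrite /levset -El => /asboolP.
    apply: (hom_level hp hn (a := code x n `|D - n|) (b := code y n `|D - n|)) => //.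
    - by apply/mem_codes => //; exists x.
    - by apply/mem_codes => //; exists y.
    - by apply/(code_eq hp xn yn (ltnW ld)); rewrite -El.
    - move=> /(code_eq hp xn yn ld); rewrite (_ : n + l.+1%:Z = i + 1) //; lia.
  (* A point and one whose digit at position i is larger by 1 modulo p, with equal lower digits,
     realise the order i. *)
  move=> Ii; have iD := ID i Ii.
  pose n := Num.min n0 i.
  have nn : n <= n0 by rewrite ge_min lexx.
  have ni : n <= i by rewrite ge_min lexx orbT.
  have Ed : n + `|D - n|%N%:Z = D by lia.
  have [l ld El] := le_level n i _ ni Ed iD.
  have [hn nz] := hE n _ nn Ed.
  have [a aA] : exists a, a \in codes E n `|D - n|.
    by case: (codes _ _ _) nz => // a A _; exists a; rewrite mem_head.
  have [|b bA ba] := hom_child hp 1 hn aA ld; first by rewrite /levset -El; apply/asboolP.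
  move: aA bA => /mem_codes [//|x [Ex xn xa]] /mem_codes [//|y [Ey yn yb]].
  have h2 : tr x (i + 1) <> tr y (i + 1).
    rewrite (_ : i + 1 = n + l.+1%:Z); last lia.
    move=> /(code_eq hp xn yn ld); rewrite xa yb ba -{1}[a]addn0 -(mul0n (p ^ l)%N).
    by move/(child_uniq hp p0 (prime_gt1 hp)).
  have h1 : tr x i = tr y i.
    rewrite El; apply/(code_eq hp xn yn (ltnW ld)); rewrite xa yb.
    by rewrite (eq_modX (leqnSn l) ba) child_mod.
  exists x, y; split=> //; split=> //; split; first by move=> xy; apply: h2; rewrite xy.
  exact/(vp_subE hp).
split=> //; split; first by exists D => i; rewrite EI => /ID /ltW.
(* Beyond D a ball meets [E] in at most one point, in agreement with p^0, since no order is at least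
   n. *)
move=> n a; rewrite EI; have [nD|Dn] := ltrP n D; last first.
  have [E0|/set0P [x [Ex xa]]] := eqVneq (E `&` B a (- n)) set0; [by left|right].
  exists 0%N; split.
    rewrite II0 card_eq0; apply/eqP/seteqP; split => // i /= [/ID].
    by lia.
  rewrite expn0 (_ : E `&` _ = [set x]) ?card_set1 //.
  apply/seteqP; split => [y [Ey ya]|y -> //].
  apply: sep => //; move: xa ya; rewrite BE /= => <- h.
  exact: (tr_eq_le hp Dn h).
have [n' [nn an _]] := tr_common_low hp a a (Num.min n0 n).
move: nn; rewrite le_min => /andP [nn ni].
have Ed : n' + `|D - n'|%N%:Z = D by lia.
have [l ld El] := le_level n' n _ ni Ed nD.
have [hn _] := hE n' _ nn Ed.
have := @card_codes E n' `|D - n'|%N l a _ an (ltnW ld); rewrite Ed -El.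
move=> /(_ (fun x y Ex Ey _ _ => sep x y Ex Ey)) hc.
case: (hn l (code a n' `|D - n'|) (ltnW ld)) => Ec; move: hc; rewrite Ec => hc.
  by left; apply/eqP; move: hc; rewrite II0 card_eq0.
right; exists (lev (levset I n') l `|D - n'|); split => //.
by rewrite El; apply: card_levset => j; rewrite Ed; apply: ID.
Qed.

(* At a level in I every ball meeting O has all its p sub-balls meeting O, at *)
(* any other level it has only one.                                           *)
Definition branching O (I : set int) :=
  (forall i x (k : nat), I i -> O x -> (k < p)%N ->
     exists2 y, O y & tr y (i + 1) = tr x i + pw p i * k%:R) /\
  (forall i x y, ~ I i -> O x -> O y -> tr x i = tr y i -> tr x (i + 1) = tr y (i + 1)).

Lemma branching_hom O I n (d : nat) : branching O I -> hom p (codes O n d) (levset I n) d.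
Proof.
move=> [full single].
suff H (k : nat) : forall i c : nat, (i <= d)%N -> (d - i = k)%N ->
    cnt p (codes O n d) i c = 0%N \/ cnt p (codes O n d) i c = (p ^ lev (levset I n) i d)%N.
  by move=> i c id; apply: (H _ i c id erefl).
elim: k => [|k IH] i c id Ek.
  have -> : i = d by lia.
  rewrite levdd; have := cnt_top c (codes_uniq O n d) (@codes_lt p O n d).
  by case: (cnt _ _ _ _) => [|[|]]; auto.
have lid : (i < d)%N by lia.
have [->|c0] := posnP (cnt p (codes O n d) i c); [by left|right].
have [a aA Ea] := (cnt_gt0 p _ i c).1 c0.
have /mem_codes [//|x [Ox xn xa]] := aA.
have Ei1 : n + i%:Z + 1 = n + i.+1%:Z by lia.
rewrite (lev_recl _ lid); have [/asboolP Ii|nI] := boolP (levset I n i); last first.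
  rewrite add0n (cnt_mod _ (esym Ea)).
  have -> : cnt p (codes O n d) i a = cnt p (codes O n d) i.+1 a.
    apply: eq_in_count => b /mem_codes [//|y [Oy yn yb]]; apply/eqP/eqP; last first.
      exact: eq_modX.
    rewrite -xa -yb => /(code_eq hp yn xn id) h; apply/(code_eq hp yn xn lid).
    rewrite -Ei1; apply: single => //; exact/asboolPn.
  have : (0 < cnt p (codes O n d) i.+1 a)%N := cnt_gt0_mem p _ aA.
  by case: (IH i.+1 a lid) => [|->//|->//]; lia.
rewrite (cnt_split hp) expnS -[p in (p * _)%N](card_ord p) -sum_nat_const.
apply: eq_bigr => j _.
have : (0 < cnt p (codes O n d) i.+1 (c + j * p ^ i))%N.
  apply/cnt_gt0; set e := (c + j * p ^ i)%N.
  (* The digit of e at position i: following it from x reaches the prescribed child class. *)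
  have [|y Oy Ey] := full _ x ((e %% p ^ i.+1) %/ p ^ i)%N Ii Ox.
    by rewrite ltn_divLR // -expnS ltn_mod.
  have Ey' : tr y (n + i.+1%:Z) = pw p n * (e %% p ^ i.+1)%:R.
    rewrite -Ei1 Ey pwD // pw_nat (code_mod hp xn id) xa Ea -mulrA -mulrDr -natrM -natrD.
    congr (_ * _%:R); rewrite [in RHS](divn_eq (e %% p ^ i.+1) (p ^ i)) addnC mulnC.
    by congr (_ + _)%N; rewrite modn_dvdm ?dvdn_exp2l // child_mod.
  have yn : tr y n = 0.
    rewrite (@tr_pmod _ hp _ _ (n + i.+1%:Z)) ?Ey'; last lia.
    by apply/pmod_eq0; rewrite ?pz_pw_nat.
  exists (code y n d); first by apply/mem_codes => //; exists y.
  apply/eqP; rewrite -(eqr_nat rat); apply/eqP/(mulfI (pw_neq0 hp n)).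
  by rewrite -(code_mod hp yn lid).
by case: (IH i.+1 (c + j * p ^ i)%N lid) => [|->//|->//]; lia.
Qed.

Lemma digit x n : exists2 k : nat, (k < p)%N & tr x (n + 1) = tr x n + pw p n * k%:R.
Proof.
have /pzP [//|z Ez] : pz p n (tr x (n + 1) - tr x n) by apply: tr_cong => //; lia.
have /andP [h1 h2] := tr_bounds hp x n; have /andP [h3 h4] := tr_bounds hp x (n + 1).
rewrite pwD // in h4; have P0 := pw_gt0 hp n; have Pp : pw p 1 = p%:R by rewrite (pw_nat p 1) expn1.
rewrite Pp in h4.
have z0 : 0 <= z.
  rewrite -ltzD1 -(ltr_int rat) rmorphD /=; nra.
have zp : z < p%:Z by rewrite -(ltr_int rat); nra.
exists `|z|%N; first lia.
by rewrite -[X in _ * X]/(`|z|%N%:Z%:~R) gez0_abs // -Ez; ring.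
Qed.

Lemma branching_ball (s : Qp p) m : branching (B s (- m)) [set i | m <= i].
Proof.
rewrite BE; split => [i x k /= mi xs kp|i x y /= mi xs ys _]; last first.
  by apply: (@tr_eq_le _ hp _ _ _ m); [lia|rewrite xs ys].
have [a xa] := tr_low x; pose N := Num.min a i.
have hz : pz p N (tr x i + pw p i * k%:R).
  apply: pzD.
    by apply: pz_le (tr_pz hp _ xa) => //; rewrite ge_min lexx.
  by apply: pz_le (pz_pw_nat hp _ _) => //; rewrite ge_min lexx orbT.
exists (of_rat p (tr x i + pw p i * k%:R)).
  rewrite (tr_of_rat hp _ hz) -xs (tr_pmod hp x mi); apply/eq_pmodP => //.
  by rewrite addrC addKr; apply: pz_le mi (pz_pw_nat hp _ _).
rewrite (tr_of_rat hp _ hz); apply: pmod_id => //.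
have /andP [h1 h2] := tr_bounds hp x i; have P0 := pw_gt0 hp i.
apply/andP; split; first by apply: addr_ge0 => //; apply: mulr_ge0; rewrite ?ler0n // ltW.
rewrite (pwD hp) (pw_nat p 1) expn1.
have : k.+1%:R <= p%:R :> rat by rewrite ler_nat.
by rewrite -natr1; nra.
Qed.

(** A level with one sub-ball splits no pair of points, so it is not admissible; at a level with p
    sub-balls the digits 0 and 1 both occur, so it is. *)
Lemma hom_set_branching O : p_homogeneous_set O -> branching O (adm_orders O).
Proof.
move=> hO.
have dich n :
  (forall x y, O x -> O y -> tr x n = tr y n -> tr x (n + 1) = tr y (n + 1)) \/
  (forall x (k : nat), O x -> (k < p)%N ->
     exists2 y, O y & tr y (n + 1) = tr x n + pw p n * k%:R).
  have sub x : B x (- (n + 1)) `<=` B x (- n).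
    by rewrite !BE => z /= h; apply: (tr_eq_le hp _ h); lia.
  have in_nb i x : O x -> Nballs O i (B x (- i)).
    by move=> Ox; exists x; split => //; exists x; split.
  case: (hO n) => h; [left => x y Ox Oy xy|right => x k Ox kp].
    have := h _ (in_nb n x Ox) => /eq_cardSP [S0 _].
    rewrite II0 card_eq0 => /eqP hS.
    have eqS S : Nballs O (n + 1) S /\ S `<=` B x (- n) -> S = S0.
      move=> hS'; apply: contrapT => ne.
      suff : @set0 (set (Qp p)) S by [].
      by rewrite -hS.
    have Ex : B x (- (n + 1)) = S0 by apply: eqS; split; [exact: in_nb|exact: sub].
    have Ey : B y (- (n + 1)) = S0.
      apply: eqS; split; first exact: in_nb.
      have -> : B x (- n) = B y (- n) by rewrite !BE xy.
      exact: sub.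
    have : B y (- (n + 1)) y by [].
    by rewrite Ey -Ex BE.
  apply: contrapT => /forall2NP nO.
  pose cb (j : nat) : set (Qp p) := [set z | tr z (n + 1) = tr x n + pw p n * j%:R].
  have := h _ (in_nb n x Ox) => hc.
  (* If the digit k did not occur, the p sub-balls would lie among the p - 1 remaining cosets. *)
  have sb : [set S' | Nballs O (n + 1) S' /\ S' `<=` B x (- n)] `<=`
      cb @` [set` rem k (iota 0 p)].
    move=> _ [[b [-> [z [zb Oz]]]] bx].
    have [j jp Ej] := digit b n.
    have bn : tr b n = tr x n by have := bx b; rewrite !BE /= => /(_ erefl).
    have Eb : B b (- (n + 1)) = cb j by rewrite BE Ej bn.
    exists j => //=; rewrite mem_rem_uniq ?iota_uniq // inE mem_iota /= jp andbT.
    apply/eqP => jk; have := zb; rewrite Eb jk => zk.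
    by case: (nO z).
  have := card_le_trans (subset_card_le sb) (card_image_le _ _).
  move=> le1; have us : uniq (rem k (iota 0 p)) by rewrite rem_uniq ?iota_uniq.
  have : `I_p #<= `I_(size (rem k (iota 0 p))).
    rewrite -(card_le_eql hc) -(card_le_eqr (card_seq us)); exact: le1.
  rewrite card_le_II size_rem ?size_iota ?mem_iota //=; move: p0; lia.
have adm_sing n : (forall x y, O x -> O y -> tr x n = tr y n -> tr x (n + 1) = tr y (n + 1)) ->
    ~ adm_orders O n.
  by move=> h [x [y [Ox [Oy [_ /(vp_subE hp) [h1 h2]]]]]]; apply: h2; apply: h.
split=> [i x k Ii Ox kp|i x y nI Ox Oy xy].
  by case: (dich i) => [/adm_sing //|h]; apply: h.
case: (dich i) => [|h]; first exact.
have [y0 Oy0 E0] := h x 0%N Ox p0; have [y1 Oy1 E1] := h x 1%N Ox (prime_gt1 hp).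
case: nI; exists y0, y1; split=> //; split=> //; split.
  move=> E; move: E0; rewrite E E1 mulr0 mulr1 addr0 => /eqP.
  by rewrite -subr_eq0 addrC addKr (negPf (pw_neq0 hp i)).
apply/(vp_subE hp); split; last first.
  rewrite E0 E1 mulr0 mulr1 addr0 => /esym/eqP.
  by rewrite -subr_eq0 addrC addKr (negPf (pw_neq0 hp i)).
have ii : i <= i + 1 by lia.
rewrite (tr_pmod hp y0 ii) (tr_pmod hp y1 ii).
apply/eq_pmodP => //; rewrite E0 E1 mulr0 addr0 opprD addrA subrr add0r pzN mulr1.
by rewrite -[pw p i]mulr1 (pz_pw_nat hp i 1).
Qed.

(** Two finite subcovers: by the balls p^(-N) Z_p for boundedness, and by balls contained in [O] for
    a uniform level of periodicity. *)
Lemma compact_open_levels O : qp_compact O -> qp_open O ->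
  exists n0 M0, (forall x, O x -> tr x n0 = 0) /\
    (forall x y, O x -> tr x M0 = tr y M0 -> O y).
Proof.
move=> cO oO.
have openB (a : Qp p) n : qp_open (B a n).
  by move=> x xa; exists n => y; rewrite /B /= => ->.
have [||N [f hf]] := cO nat (fun N => B (qp0 p) N%:Z).
- by move=> N; apply: openB.
- move=> x _; have [a xa] := tr_low x; exists `|a|%N => //=; rewrite /B /=.
  by apply: (tr0_le hp _ xa); lia.
have [||M [g hg]] := cO (Qp p * int)%type
    (fun c => [set x | B c.1 (- c.2) x /\ B c.1 (- c.2) `<=` O]).
- move=> c x /= [xc cO']; exists (- c.2) => y xy; split => //.
  by move: xc xy; rewrite /B /= => <-.
- move=> x Ox; have [n hn] := oO x Ox; exists (x, - n) => //=; rewrite opprK.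
  by split.
pose F (j : 'I_M) : nat := `|(g j).2|%N.
exists (- (\max_(j < N) f j)%N%:Z), ((\max_j F j)%N%:Z); split.
  move=> x /hf [j _]; rewrite /B /= => h; apply: (tr0_le hp _ h).
  by rewrite lerN2 lez_nat (leq_bigmax j).
move=> x y /hg [j _ /= [xg gO]] xy; apply: gO; move: xg; rewrite !BE /= => <-.
apply/esym/(tr_eq_le hp _ xy).
have : (F j <= \max_j F j)%N by exact: leq_bigmax.
move: (\max_j F j)%N => K; rewrite /F; lia.
Qed.

End Homogeneous.

(** * Tilings and characters *)

Section Tiling.
Variables (p : nat) (hp : prime p).
Implicit Types (k m n i j : int) (x y t : Qp p) (O T : set (Qp p)).

Let p0 : (0 < p)%N := prime_gt0 hp.
Let pX0 (i : nat) : (0 < p ^ i)%N. Proof. by rewrite expn_gt0 p0. Qed.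

Lemma levsetC (I : set int) n : levset (~` I) n = predC (levset I n).
Proof. by apply/funext => l; rewrite /levset /= -asbool_neg. Qed.

(** Beyond the periodicity level [O] contains a whole ball around x, where the digits 0 and 1 both
    occur. *)
Lemma branching_above O I M0 x i : branching O I -> O x ->
  (forall x y, O x -> tr x M0 = tr y M0 -> O y) -> M0 <= i -> I i.
Proof.
move=> [_ single] Ox per Mi; apply: contrapT => nI.
have [full _] := branching_ball hp x i.
have [] := full i x 0%N; rewrite ?lexx //= => y0.
rewrite BE /= => xy0 E0.
have [] := full i x 1%N; rewrite ?lexx ?prime_gt1 //= => y1.
rewrite BE /= => xy1 E1.
have Oy y : tr y i = tr x i -> O y.
  by move=> h; apply: (per x) => //; apply/esym/(tr_eq_le hp Mi h).
have := single i y0 y1 nI (Oy _ xy0) (Oy _ xy1); rewrite xy0 xy1 => /(_ erefl).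
rewrite E0 E1 mulr0 mulr1 addr0 => /esym/eqP.
by rewrite -subr_eq0 addrC addKr (negPf (pw_neq0 hp i)).
Qed.

Lemma branching_below O I n0 x i : branching O I -> O x ->
  (forall x, O x -> tr x n0 = 0) -> I i -> n0 <= i.
Proof.
move=> [full _] Ox low Ii; rewrite leNgt; apply/negP => lt.
have [y Oy Ey] := full i x 1%N Ii Ox (prime_gt1 hp).
have h z j : j <= n0 -> O z -> tr z j = 0 by move=> jn /low; apply: tr0_le.
move: Ey; rewrite !h //; [|lia|lia]; rewrite add0r mulr1 => /esym/eqP.
by rewrite (negPf (pw_neq0 hp i)).
Qed.

Definition exact_tiling O T :=
  (forall x, exists2 t, T t & O (qsub x t)) /\
  (forall x t t', T t -> T t' -> O (qsub x t) -> O (qsub x t') -> t = t').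

Lemma tr_sub_inj x t t' k : tr (qsub x t) k = tr (qsub x t') k <-> tr t k = tr t' k.
Proof.
rewrite !tr_sub //; split=> [/eq_pmodP|E].
  move=> /(_ hp); rewrite opprB addrACA addrC [- tr t k + _]addrC.
  rewrite (_ : _ + _ = tr t' k - tr t k); last by ring.
  by rewrite pzBC // => h; apply/(@tr_eq _ hp _ _ _ k k).
by rewrite E.
Qed.

(** The witness is w + t, built from residues. Two translations congruent modulo p^M0 both cover it,
    so in an exact tiling they coincide. *)
Lemma exact_tiling_shift O (w t : Qp p) M0 :
  (forall x y, O x -> tr x M0 = tr y M0 -> O y) -> O w ->
  exists x, forall t', tr t' M0 = tr t M0 -> O (qsub x t').
Proof.
move=> per Ow; have [n [nM wn tn]] := tr_common_low hp w t M0.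
pose d := `|M0 - n|%N; have Ed : n + d%:Z = M0 by rewrite /d; lia.
exists (rep p n ((code w n d + code t n d) %% p ^ d)) => t' tt'.
have t'n : tr t' n = 0 by rewrite (tr_eq_le hp nM tt').
apply: (per w) => //; rewrite -Ed; set x := rep _ _ _.
have xn : tr x n = 0 by apply: tr_rep_low.
have sn : tr (qsub x t') n = 0 by apply/(tr_sub_eq0 hp); rewrite xn t'n.
apply/(code_inj hp d wn sn).
have := code_sub hp d xn t'n.
have -> : code t' n d = code t n d by apply/(code_inj hp d t'n tn); rewrite Ed.
have -> : code x n d = ((code w n d + code t n d) %% p ^ d)%N.
  by apply: code_rep => //; rewrite ltn_mod.
rewrite modn_mod => /eqP.
by rewrite eqn_modDr !modn_small ?code_lt // => /eqP.
Qed.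

Section TilingHom.
Variables (O : set (Qp p)) (n0 M0 : int).
Hypotheses (low : forall x, O x -> tr x n0 = 0)
  (per : forall x y, O x -> tr x M0 = tr y M0 -> O y)
  (nM : n0 <= M0) (Onz : exists w, O w) (br : branching O (adm_orders O)).

(** Since [O] lies in p^n Z_p, a point of p^n Z_p can only be covered by a translation from p^n Z_p,
    so the tiling restricts to this subgroup and then descends modulo p^M0. *)
Lemma exact_tiling_tiles T n (d : nat) : exact_tiling O T -> n <= n0 -> n + d%:Z = M0 ->
  tiles p (codes O n d) (codes T n d) d.
Proof.
move=> [ex un] nn Ed.
have lown x : O x -> tr x n = 0 by move=> /low; apply: tr0_le.
have inj : {in [seq (a, c) | a <- codes O n d, c <- codes T n d] &,
    injective (fun z : nat * nat => (z.1 + z.2) %% p ^ d)%N}.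
  move=> _ _ /allpairsP [[a c] /= [aA tT ->]] /allpairsP [[b s] /= [bA sT ->]] /= E.
  move: (aA) (bA) => /mem_codes [//|x [Ox xn xa]] /mem_codes [//|y [Oy yn yb]].
  move: (tT) (sT) => /mem_codes [//|t' [Tt tn tc]] /mem_codes [//|s' [Ts sn ss]].
  pose g := rep p n ((a + c) %% p ^ d).
  have gn : tr g n = 0 by apply: tr_rep_low.
  have key z r : tr z n = 0 -> tr r n = 0 ->
      ((code z n d + code r n d) %% p ^ d = (a + c) %% p ^ d)%N -> O z -> O (qsub g r).
    move=> zn rn Ezr Oz; apply: (per Oz); rewrite -Ed.
    have qn : tr (qsub g r) n = 0 by apply/(tr_sub_eq0 hp); rewrite gn rn.
    apply/(code_inj hp d zn qn); have := code_sub hp d gn rn.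
    have -> : code g n d = ((a + c) %% p ^ d)%N by apply: code_rep => //; rewrite ltn_mod.
    rewrite modn_mod -Ezr => /eqP.
    by rewrite eqn_modDr !modn_small ?code_lt // => /eqP.
  have ts : t' = s'.
    apply: (un g) => //; first by apply: (key x t') => //; rewrite xa tc.
    by apply: (key y s') => //; rewrite yb ss E.
  have Ecs : c = s by rewrite -tc -ss ts.
  move: E => /eqP; rewrite Ecs eqn_modDr !modn_small ?(codes_lt aA) ?(codes_lt bA) //.
  by move=> /eqP ->.
rewrite /tiles.
have -> : [seq (a + c) %% p ^ d | a <- codes O n d, c <- codes T n d]%N =
  [seq (z.1 + z.2) %% p ^ d | z <- [seq (a, c) | a <- codes O n d, c <- codes T n d]]%N.
  by rewrite map_allpairs.
apply: uniq_perm; rewrite ?iota_uniq //.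
  by rewrite map_inj_in_uniq // allpairs_uniq ?codes_uniq // => -[? ?] [? ?] _ _ [-> ->].
move=> g; rewrite mem_iota /= add0n; apply/idP/idP => [/mapP [x _ ->]|gd].
  by rewrite ltn_mod.
have [t Tt Ot] := ex (rep p n g).
have gn : tr (rep p n g) n = 0 by apply: tr_rep_low.
have tn : tr t n = 0 by rewrite -((tr_sub_eq0 hp _ _ _).1 (lown _ Ot)).
apply/mapP; exists (code (qsub (rep p n g) t) n d, code t n d).
  apply: allpairs_f; apply/mem_codes => //; [exists (qsub (rep p n g) t)|exists t]; split=> //.
  exact: lown.
by rewrite /= (code_sub hp d gn tn) (code_rep hp n gd) modn_small.
Qed.

Lemma exact_tiling_phd T : exact_tiling O T <->
  p_homogeneous_discrete T /\ adm_orders T = ~` adm_orders O.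
Proof.
have [w Ow] := Onz.
have above i : M0 <= i -> adm_orders O i := branching_above br Ow per.
split=> [til|[hT aT]].
  apply: (@codes_phd p hp T _ M0 n0).
  - by move=> i nI; rewrite ltNge; apply/negP => /above.
  - move=> t t' Tt Tt' tt'; have [x hx] := exact_tiling_shift t per Ow.
    by case: til => _ un; apply: (un x) => //; apply: hx.
  - move=> n d nn Ed; have tl := exact_tiling_tiles til nn Ed; split.
      rewrite levsetC; apply: tiles_hom tl => //; exact: branching_hom.
    apply/eqP => T0; move: (perm_size tl); rewrite T0 size_iota.
    by rewrite size_allpairs muln0 => /esym/eqP; rewrite -leqn0 leqNgt pX0.
have Dlt i : adm_orders T i -> i < M0.
  by rewrite aT ltNge => nI; apply/negP => /above.
have [sep hcod] := phd_codes hp hT Dlt.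
have [t0 Tt0] : exists t, T t.
  (* T is nonempty: orders of [O] are at least n0, so n0 - 1 is an order of T. *)
  have : adm_orders T (n0 - 1).
    by rewrite aT => /(branching_below br Ow low); lia.
  by move=> [t [_ [Tt _]]]; exists t.
split=> [x|x t t' Tt Tt' Ot Ot']; last first.
  (* The points x - t and x - t' of [O] differ by the valuation of t - t', which would be an order
     of both sets. *)
  apply: contrapT => ntt; have [i vi] := neq_split hp ntt.
  have : adm_orders T i by exists t, t'.
  rewrite aT; apply; exists (qsub x t), (qsub x t'); split=> //; split=> //.
  move/(vp_subE hp): vi => [h1 h2].
  split; first by move=> E; apply: h2; apply/(tr_sub_inj x); rewrite E.
  apply/(vp_subE hp); split; first exact/tr_sub_inj.
  by move/tr_sub_inj.
have [n [nn xn tn]] := tr_common_low hp x t0 n0.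
pose d := `|M0 - n|%N; have Ed : n + d%:Z = M0 by rewrite /d; lia.
have lown y : O y -> tr y n = 0 by move=> /low; apply: tr0_le.
have tl : tiles p (codes O n d) (codes T n d) d.
  apply: (@hom_tiles p hp _ _ (levset (adm_orders O) n)); rewrite ?codes_uniq //.
  - exact: branching_hom.
  - by rewrite -levsetC -aT; apply: hcod.
  - have : code w n d \in codes O n d by apply/mem_codes => //; exists w; split=> //; apply: lown.
    by case: (codes _ _ _).
  - have : code t0 n d \in codes T n d by apply/mem_codes => //; exists t0.
    by case: (codes _ _ _).
  - exact: codes_lt.
  - exact: codes_lt.
have : code x n d \in [seq (a + c) %% p ^ d | a <- codes O n d, c <- codes T n d]%N.
  by rewrite (perm_mem tl) mem_iota /= add0n code_lt.
move=> /allpairsP [[a c] /= [/mem_codes [//|y [Oy yn ya]] /mem_codes [//|t [Tt ttn tc]] E]].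
exists t => //; apply: (per Oy); rewrite -Ed.
have sn : tr (qsub x t) n = 0 by apply/(tr_sub_eq0 hp); rewrite xn ttn.
apply/(code_inj hp d yn sn); have := code_sub hp d xn ttn.
rewrite -[in RHS](modn_small (code_lt hp d xn)) modn_mod E -ya -tc modn_mod => /eqP.
by rewrite eqn_modDr !modn_small ?code_lt // => /eqP.
Qed.

End TilingHom.
End Tiling.

(** * Additive characters of Q_p *)

Section Characters.
Variable R : realType.

Definition ec (r : rat) : R[i] :=
  Complex (cos (2 * pi * ratr r)) (sin (2 * pi * ratr r)).

Lemma ecD r s : ec (r + s) = ec r * ec s.
Proof.
rewrite /ec rmorphD mulrDr cosD sinD; simpc.
by congr Complex; rewrite addrC.
Qed.

Lemma ec0 : ec 0 = 1.
Proof. by rewrite /ec rmorph0 mulr0 cos0 sin0. Qed.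

Lemma ec_nat n : ec n%:R = 1.
Proof.
have e1 : ec 1 = 1 by rewrite /ec rmorph1 mulr1 mulr_natl cos2pi sin2pi.
by elim: n => [|n IH]; rewrite ?ec0 // -natr1 ecD IH e1 mulr1.
Qed.

Lemma ecV r : ec r * ec (- r) = 1.
Proof. by rewrite -ecD subrr ec0. Qed.

Lemma ec_int r : r \is a Num.int -> ec r = 1.
Proof.
move=> /intrP [[n|n] ->]; first exact: ec_nat.
rewrite NegzE rmorphN /=; have := ecV n.+1%:R.
by rewrite ec_nat mul1r.
Qed.

Lemma ec_eq r s : r - s \is a Num.int -> ec r = ec s.
Proof. by move=> h; rewrite -[r](subrK s) ecD ec_int // mul1r. Qed.

Lemma ecX r n : ec r ^+ n = ec (r * n%:R).
Proof.
elim: n => [|n IH]; first by rewrite mulr0 ec0.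
by rewrite exprSr IH -natr1 mulrDr mulr1 ecD.
Qed.

(** For the fractional part t, cos(2 pi t) = 1 forces sin(pi t) = 0 by the double-angle formula,
    whereas the sine is positive for 0 < t < 1. *)
Lemma ec_eq1 r : ec r = 1 -> r \is a Num.int.
Proof.
move=> er; pose f := (Num.floor r)%:~R : rat; pose t := r - f.
have et : ec t = 1 by rewrite -er; apply: ec_eq; rewrite /t addrC addKr rpredN intr_int.
have /andP [t0 t1] : 0 <= t < 1.
  have /andP [h1 h2] := floor_itv r; rewrite /t subr_ge0 h1 ltrBlDl.
  by move: h2; rewrite intrD addrC.
have ct : cos (2 * pi * ratr t) = 1 :> R by case: et.
suff tz : t = 0.
  by rewrite (_ : r = f) ?intr_int //; apply/eqP; rewrite -subr_eq0 -/t tz.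
apply/eqP; rewrite -[_ == 0]negbK; apply/negP => tn.
have tp : 0 < t by rewrite lt_neqAle eq_sym tn.
have : 0 < sin (pi * ratr t) :> R.
  apply: sin_gt0_pi; rewrite mulr_gt0 ?pi_gt0 ?ltr0q //=.
  by rewrite -[ltRHS]mulr1 ltr_pM2l ?pi_gt0 // -(rmorph1 (@ratr R)) ltr_rat.
move: ct; rewrite -mulrA mulr_natl cos_mulr2n => ct s0.
have := cos2Dsin2 (pi * ratr t : R) => cs.
have : sin (pi * ratr t : R) ^+ 2 = 0 by rewrite mulr2n in ct; lra.
by move/eqP; rewrite sqrf_eq0 gt_eqF.
Qed.

Lemma ReM_ecN r s : (complex.Re (ec r) * complex.Re (ec s) + complex.Im (ec r) * complex.Im (ec s)
  = complex.Re (ec (r - s))).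
Proof. by rewrite /= rmorphB mulrBr cosB. Qed.

Lemma ImM_ecN r s : (complex.Im (ec r) * complex.Re (ec s) - complex.Re (ec r) * complex.Im (ec s)
  = complex.Im (ec (r - s))).
Proof. by rewrite /= rmorphB mulrBr sinB. Qed.

Variables (p : nat) (hp : prime p).
Implicit Types (l x : Qp p).

(** The frequency w has valuation - n - i - 1, so e(w p^n) is a root of unity of exact order
    p^(i+1); this is where frequencies meet levels. *)
Lemma sum_ec A w (n : int) (i : nat) (u : int) :
  w = pw p (- n - i%:Z - 1) * u%:~R -> ~~ (p %| u)%Z ->
  \sum_(a <- A) ec (w * (pw p n * a%:R)) = 0 <-> equi p A i.
Proof.
move=> Ew pu; pose z := ec (w * pw p n).
have -> : \sum_(a <- A) ec (w * (pw p n * a%:R)) = \sum_(a <- A) z ^+ a.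
  by apply: eq_bigr => a _; rewrite /z ecX mulrA.
have p0 : (0 < p)%N := prime_gt0 hp.
have Ez j : z ^+ (p ^ j) = ec (pw p (j%:Z - i%:Z - 1) * u%:~R).
  rewrite /z ecX Ew -pw_nat; congr ec.
  rewrite (_ : j%:Z - i%:Z - 1 = (- n - i%:Z - 1) + n + j%:Z); last lia.
  rewrite (pwD hp (- n - i%:Z - 1 + n)) (pwD hp (- n - i%:Z - 1)).
  by rewrite -!mulrA; congr (_ * _); rewrite mulrC -mulrA.
have z1 : z ^+ (p ^ i.+1) = 1.
  rewrite Ez (_ : _ - _ - _ = 0); last lia.
  by rewrite pw0 mul1r ec_int // intr_int.
have zn1 : z ^+ (p ^ i) != 1.
  rewrite Ez; apply/eqP => /ec_eq1 /intrP [v Ev].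
  case/negP: pu; apply/dvdzP; exists v.
  apply/eqP; rewrite -(eqr_int rat) intrM -Ev (_ : _ - _ - _ = -1); last lia.
  rewrite mulrAC (_ : p%:~R = pw p 1); last by rewrite (pw_nat p 1) expn1.
  by rewrite -(pwD hp) pw0 mul1r.
by split; [apply: (sum0_equi hp z1 zn1)|apply: (equi_sum0 hp z1 zn1)].
Qed.

Definition chi l x : R[i] := ec (pfrac (qmul l x)).

Lemma chi_reE l x : chi_re R l x = complex.Re (chi l x).
Proof. by []. Qed.

Lemma chi_imE l x : chi_im R l x = complex.Im (chi l x).
Proof. by []. Qed.

Lemma pfrac_mul l x (a b m n : int) : tr l a = 0 -> tr x b = 0 -> - b <= m -> - a <= n ->
  tr l m * tr x n - pfrac (qmul l x) \is a Num.int.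
Proof.
move=> la xb hm hn; rewrite /pfrac (@tr_mul _ hp l x a b 0 m n) ?sub0r //.
by have := pmod_pz hp (tr l m * tr x n) 0; rewrite /pz pw0 divr1.
Qed.

Lemma chiE l x (a b m n : int) : tr l a = 0 -> tr x b = 0 -> - b <= m -> - a <= n ->
  chi l x = ec (tr l m * tr x n).
Proof. by move=> la xb hm hn; apply/esym/ec_eq; apply: pfrac_mul la xb hm hn. Qed.

End Characters.

(** * Haar measure *)

Section HaarMeasure.
Variables (R : realType) (p : nat) (hp : prime p).
Variables (mu : {measure set (QpB p) -> \bar R}) (Hmu : is_haar mu).
Implicit Types (k m n i j : int) (x y t : Qp p) (O : set (Qp p)).

Let p0 : (0 < p)%N := prime_gt0 hp.
Let pX0 (i : nat) : (0 < p ^ i)%N. Proof. by rewrite expn_gt0 p0. Qed.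

Definition level_ball k (r : rat) : set (QpB p) := [set x | tr x k = r].

Lemma open_meas (U : set (QpB p)) : qp_open U -> measurable U.
Proof. by move=> oU; apply: sub_sigma_algebra. Qed.

Lemma level_open k (U : set (Qp p)) : (forall x y, tr x k = tr y k -> U x -> U y) -> qp_open U.
Proof. by move=> h x Ux; exists (- k) => y; rewrite BE /= => xy; apply: (h x). Qed.

Lemma level_meas k (U : set (QpB p)) : (forall x y : QpB p, tr x k = tr y k -> U x -> U y) ->
  measurable U.
Proof. by move=> h; apply: open_meas; apply: level_open h. Qed.

Lemma cball_meas k r : measurable (level_ball k r).
Proof. by apply: (@level_meas k) => x y; rewrite /level_ball /= => ->. Qed.

Lemma level_meas_fun k (D : set (QpB p)) (f : QpB p -> R) : measurable D ->
  (forall x y : QpB p, tr x k = tr y k -> f x = f y) -> measurable_fun D f.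
Proof.
move=> mD h; apply: (@measurable_funS _ _ _ _ setT) => // _ Y mY.
apply: measurableI => //; apply: (@level_meas k) => x y /h; rewrite /preimage /= => ->.
by [].
Qed.

Definition beta k : \bar R := mu (level_ball k 0).

Lemma mu_ball k (a : Qp p) : mu (level_ball k (tr a k)) = beta k.
Proof.
rewrite /beta -(Hmu.1 (level_ball k 0) a); last exact: cball_meas.
congr (mu _); apply/seteqP; split => x /=; rewrite /level_ball /=.
  by move=> h; apply/tr_sub_eq0.
by move/(tr_sub_eq0 hp).
Qed.

Lemma codes_cover O n (d : nat) : (forall x, O x -> tr x n = 0) ->
  (forall x y, O x -> tr x (n + d%:Z) = tr y (n + d%:Z) -> O y) ->
  (O : set (QpB p)) =
    \big[setU/set0]_(c <- codes O n d) level_ball (n + d%:Z) (pw p n * c%:R).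
Proof.
move=> low per; rewrite -bigcup_seq; apply/seteqP; split => x /=.
  move=> Ox; exists (code x n d); first by apply/mem_codes => //; exists x; split => //; apply: low.
  by rewrite /level_ball /= codeE //; apply: low.
move=> [c /= /mem_codes [//|y [Oy yn <-]]]; rewrite /level_ball /= -codeE // => E.
exact: (per y).
Qed.

Lemma cball_triv (s : seq nat) n (d : nat) :
  trivIset [set` s] (fun c : nat => level_ball (n + d%:Z) (pw p n * c%:R)).
Proof.
move=> a b _ _ [x []]; rewrite /level_ball /= => -> /(mulfI (pw_neq0 hp n)) /eqP.
by rewrite eqr_nat => /eqP.
Qed.

Lemma integral_codes O n (d : nat) (f : Qp p -> R) : (forall x, O x -> tr x n = 0) ->
  (forall x y, O x -> tr x (n + d%:Z) = tr y (n + d%:Z) -> O y) ->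
  (forall x y, tr x (n + d%:Z) = tr y (n + d%:Z) -> f x = f y) ->
  (\int[mu]_(x in (O : set (QpB p))) (f x)%:E =
   \sum_(c <- codes O n d) (f (rep p n c))%:E * beta (n + d%:Z))%E.
Proof.
move=> low per fc; rewrite {1}(codes_cover low per).
rewrite integral_bigsetU_EFin; last first.
- apply/measurable_EFinP; apply: (@level_meas_fun (n + d%:Z)) => //.
  by apply: bigsetU_measurable => c _; apply: cball_meas.
- exact: cball_triv.
- exact: codes_uniq.
- by move=> c; apply: cball_meas.
rewrite big_seq [RHS]big_seq; apply: eq_bigr => c cO.
have E : pw p n * c%:R = tr (rep p n c) (n + d%:Z).
  by rewrite tr_rep_nat // modn_small // (codes_lt cO).
rewrite -(mu_ball _ (rep p n c)) E -integral_cst; last exact: cball_meas.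
by apply: eq_integral => x /set_mem; rewrite /level_ball /= => /fc ->.
Qed.

Lemma measure_codes O n (d : nat) : (forall x, O x -> tr x n = 0) ->
  (forall x y, O x -> tr x (n + d%:Z) = tr y (n + d%:Z) -> O y) ->
  (mu (O : set (QpB p)) = (size (codes O n d))%:R%:E * beta (n + d%:Z))%E.
Proof.
move=> low per.
have mO : measurable (O : set (QpB p)).
  by apply: (@level_meas (n + d%:Z)) => x y xy Ox; apply: (per x).
transitivity (\int[mu]_(x in (O : set (QpB p))) (cst (1 : R) x)%:E)%E.
  by rewrite -[LHS]mul1e -(integral_cst mu mO).
rewrite (@integral_codes O n d (cst 1) low per) //.
rewrite (eq_bigr (fun=> beta (n + d%:Z))); last by move=> c _; rewrite mul1e.
elim: (codes O n d) => [|c s IH]; first by rewrite big_nil mul0e.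
by rewrite big_cons IH /= -add1n natrD EFinD ge0_muleDl ?lee_fin // mul1e.
Qed.

Lemma beta_scale n (d : nat) : (beta n = (p ^ d)%:R%:E * beta (n + d%:Z))%E.
Proof.
have -> : beta n = mu (level_ball n 0) by [].
rewrite (@measure_codes (level_ball n 0) n d).
- congr ((_%:R)%:E * _)%E; rewrite /codes (_ : [seq _ <- _ | _] = iota 0 (p ^ d)) ?size_iota //.
  apply/all_filterP/allP => c; rewrite mem_iota /= add0n => cd; apply/asboolP.
  by exists (rep p n c); split; rewrite ?code_rep // /level_ball /= tr_rep_low.
- by [].
- by rewrite /level_ball /= => x y <- h; apply/esym/(tr_eq_le hp _ h); lia.
Qed.

(** The normalisation at level 0 propagates to finer and to coarser levels through [beta_scale]. *)
Lemma beta_pos k : (0 < beta k)%E /\ beta k \is a fin_num.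
Proof.
have b0 : beta 0 = 1%E.
  by rewrite -Hmu.2; congr (mu _); rewrite /Zp /B /level_ball oppr0.
have [k0|k0] := lerP 0 k.
  have := beta_scale 0 `|k|%N; rewrite add0r gez0_abs // b0.
  have : (0 <= beta k)%E by apply: measure_ge0.
  case: (beta k) => [b| |] //.
    rewrite lee_fin => bge h; split=> //; rewrite lte_fin lt_neqAle bge andbT.
    by apply/eqP => bz; move: h; rewrite -bz mule0 => /eqP; rewrite onee_eq0.
  by move=> _; rewrite mulry gtr0_sg ?ltr0n // mul1e.
have := beta_scale k `|k|%N; rewrite (_ : k + _ = 0); last lia.
by rewrite b0 mule1 => ->; rewrite lte_fin ltr0n.
Qed.

Definition bet k : R := fine (beta k).

Lemma betE k : beta k = (bet k)%:E.
Proof. by rewrite /bet fineK //; have [] := beta_pos k. Qed.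

Lemma bet_gt0 k : 0 < bet k.
Proof. by have [+ _] := beta_pos k; rewrite betE lte_fin. Qed.

Lemma integral_codes_re O n (d : nat) (g : Qp p -> R[i]) : (forall x, O x -> tr x n = 0) ->
  (forall x y, O x -> tr x (n + d%:Z) = tr y (n + d%:Z) -> O y) ->
  (forall x y, tr x (n + d%:Z) = tr y (n + d%:Z) -> g x = g y) ->
  (\int[mu]_(x in (O : set (QpB p))) (complex.Re (g x))%:E =
   (bet (n + d%:Z) * complex.Re (\sum_(c <- codes O n d) g (rep p n c)))%:E)%E.
Proof.
move=> low per gc; rewrite (@integral_codes O n d (fun x => complex.Re (g x)) low per); last first.
  by move=> x y /gc ->.
rewrite raddf_sum mulr_sumr -sumEFin; apply: eq_bigr => c _.
by rewrite betE -EFinM mulrC.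
Qed.

Lemma integral_codes_im O n (d : nat) (g : Qp p -> R[i]) : (forall x, O x -> tr x n = 0) ->
  (forall x y, O x -> tr x (n + d%:Z) = tr y (n + d%:Z) -> O y) ->
  (forall x y, tr x (n + d%:Z) = tr y (n + d%:Z) -> g x = g y) ->
  (\int[mu]_(x in (O : set (QpB p))) (complex.Im (g x))%:E =
   (bet (n + d%:Z) * complex.Im (\sum_(c <- codes O n d) g (rep p n c)))%:E)%E.
Proof.
move=> low per gc; rewrite (@integral_codes O n d (fun x => complex.Im (g x)) low per); last first.
  by move=> x y /gc ->.
rewrite raddf_sum mulr_sumr -sumEFin; apply: eq_bigr => c _.
by rewrite betE -EFinM mulrC.
Qed.

(* Balls have positive measure. *)
Lemma ae_level k (P : Qp p -> Prop) : (forall x y, tr x k = tr y k -> P x -> P y) ->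
  {ae mu, forall x : QpB p, P x} -> forall x, P x.
Proof.
move=> Pc [N [mN N0 sub]] x; apply: contrapT => nP.
have : (mu (level_ball k (tr x k)) <= mu N)%E.
  apply: le_measure; rewrite ?inE //; first exact: cball_meas.
  move=> y; rewrite /level_ball /= => yx; apply: sub => /= Py; apply: nP; exact: Pc Py.
by rewrite N0 mu_ball leNgt (beta_pos k).1.
Qed.

Lemma esum_indic_eq1 (S T : set (Qp p)) :
  (\esum_(t in T) (\1_S t : R)%:E = 1)%E <-> exists t, T `&` S = [set t].
Proof.
have -> : (\esum_(t in T) (\1_S t : R)%:E = \esum_(t in T `&` S) 1)%E.
  rewrite esum_mkcondr; apply: eq_esum => t _; rewrite indicE.
  by case: (t \in S).
split=> [h|[t ->]]; last by rewrite esum_set1 ?lee01.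
have [E0|/set0P [t TSt]] := eqVneq (T `&` S) set0.
  by move: h; rewrite E0 esum_set0 => /eqP; rewrite eq_sym onee_eq0.
exists t; apply/seteqP; split=> [t' TSt'|_ ->//] /=.
apply: contrapT => ne.
have : (2%:E <= \esum_(t in T `&` S) (1 : \bar R))%E.
  apply: esum_ge; exists [set t; t'].
    split; first exact: finite_set2.
    by move=> _ [] ->.
  rewrite fsbigU ?fsbig_set1 //=; last by move=> u [-> /esym].
by rewrite h lee_fin leNgt ltr1n.
Qed.

(** The tiling equation at x depends only on x modulo p^M0, so a failure would persist on a ball of
    positive measure. *)
Lemma tiling_exact O T M0 : (forall x y, O x -> tr x M0 = tr y M0 -> O y) ->
  tiling_complement mu O T <-> exact_tiling O T.
Proof.
move=> per.
have perE x y t : tr x M0 = tr y M0 -> O (qsub x t) -> O (qsub y t).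
  by move=> xy Ox; apply: (per _ _ Ox); rewrite !tr_sub // xy.
pose P x := (\esum_(t in T) (\1_O (qsub x t) : R)%:E = 1)%E.
have PE x : P x <-> exists t, T `&` [set t | O (qsub x t)] = [set t].
  rewrite -esum_indic_eq1 /P.
  have -> // : (\esum_(t in T) (\1_O (qsub x t) : R)%:E =
      \esum_(t in T) (\1_[set t | O (qsub x t)] t : R)%:E)%E.
  apply: eq_esum => t _; rewrite /= !indicE; congr ((nat_of_bool _)%:R)%:E.
have Pc x y : tr x M0 = tr y M0 -> P x -> P y.
  move=> xy /PE [t Et]; apply/PE; exists t; rewrite -Et.
  by congr (_ `&` _); apply/seteqP; split => s /=; apply: perE.
split=> [til|[ex un]].
  have al := ae_level Pc til; split=> [x|x t t' Tt Tt' Ot Ot'].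
    have /PE [t Et] := al x; have : [set t] t by [].
    by rewrite -Et => -[Tt Ot]; exists t.
  have /PE [s Es] := al x.
  have : [set s] t by rewrite -Es.
  have : [set s] t' by rewrite -Es.
  by move=> -> ->.
apply: aeW => x; apply/PE; have [t Tt Ot] := ex x; exists t.
by apply/seteqP; split=> [s [Ts Os]|_ -> //]; apply: (un x).
Qed.

End HaarMeasure.

(** * Spectra are homogeneous *)

Lemma lev_rev (J : pred nat) d : lev (fun i => J (d - i.+1)%N) 0 d = lev J 0 d.
Proof.
rewrite /lev /index_iota subn0 -[LHS]count_map.
apply/permP/uniq_perm; rewrite ?iota_uniq //.
  rewrite map_inj_in_uniq ?iota_uniq // => a b; rewrite !mem_iota /= !add0n; lia.
move=> a; rewrite mem_iota /= add0n; apply/mapP/idP => [[b]|ad].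
  by rewrite mem_iota => /andP [_]; rewrite add0n => bd ->; lia.
by exists (d - a.+1)%N; [rewrite mem_iota /= add0n|]; lia.
Qed.

Section Spectrum.
Variables (R : realType) (p : nat) (hp : prime p).
Variables (mu : {measure set (QpB p) -> \bar R}) (Hmu : is_haar mu).
Implicit Types (k m n i j : int) (x y s l : Qp p).

Local Notation ec := (ec R).
Local Notation bet := (bet mu).

Lemma ec_conj_re (z : R[i]) q :
  complex.Re z * complex.Re (ec q) + complex.Im z * complex.Im (ec q) = complex.Re (z * ec (- q)).
Proof. by case: z => a b; rewrite /= rmorphN mulrN cosN sinN; ring. Qed.

Lemma ec_conj_im (z : R[i]) q :
  complex.Im z * complex.Re (ec q) - complex.Re z * complex.Im (ec q) = complex.Im (z * ec (- q)).
Proof. by case: z => a b; rewrite /= rmorphN mulrN cosN sinN; ring. Qed.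

Lemma sum_ec_zero A (q : nat -> rat) : (forall a, a \in A -> q a \is a Num.int) ->
  \sum_(a <- A) ec (q a) = (size A)%:R.
Proof.
move=> h; rewrite big_seq (eq_bigr (fun=> 1)); last by move=> a /h /ec_int ->.
by rewrite -big_seq big_const_seq count_predT iter_addr_0.
Qed.

Lemma sum_branching (E : set (Qp p)) (I : set int) n (d : nat) (w : rat) j (u : int) a :
  branching E I -> w = pw p j * u%:~R -> ~~ (p %| u)%Z -> n <= - j - 1 -> - j - 1 < n + d%:Z ->
  a \in codes E n d ->
  \sum_(c <- codes E n d) ec (w * (pw p n * c%:R)) = 0 <-> I (- j - 1).
Proof.
move=> br Ew pu nj jd aA; pose i := `|(- j - 1 - n)%R|%N.
have Ei : n + i%:Z = - j - 1 by rewrite /i; lia.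
have id : (i < d)%N by lia.
have hA := @branching_hom p hp _ _ n d br.
rewrite (@sum_ec R p hp _ w n i u) //; last by rewrite Ew; congr (pw p _ * _); lia.
split=> [eqA|Ij].
  apply: contrapT => nI; apply: (hom_not_equi hp hA aA id) eqA.
  by rewrite /levset Ei; apply/asboolPn.
by apply: (hom_equi hp hA id); rewrite /levset Ei; apply/asboolP.
Qed.

Section OneSet.
Variables (O : set (Qp p)) (n0 M0 : int) (w0 : Qp p).
Hypotheses (low : forall x, O x -> tr x n0 = 0)
  (per0 : forall x y, O x -> tr x M0 = tr y M0 -> O y)
  (nM : n0 <= M0) (Ow : O w0) (br : branching O (adm_orders O)).

Lemma per_le m : M0 <= m -> forall x y, O x -> tr x m = tr y m -> O y.
Proof. by move=> Mm x y Ox xy; apply: (per0 Ox); apply: (tr_eq_le hp Mm xy). Qed.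

Lemma measO : measurable (O : set (QpB p)).
Proof. by apply: (@level_meas p M0) => x y xy Ox; apply: (per0 Ox). Qed.

Lemma w0_codes (d : nat) : code w0 n0 d \in codes O n0 d.
Proof. by apply/mem_codes => //; exists w0; split=> //; apply: low. Qed.

Lemma size_codes_gt0 (d : nat) : (0 < size (codes O n0 d))%N.
Proof. by have := w0_codes d; case: (codes _ _ _). Qed.

Lemma muO (d : nat) : M0 <= n0 + d%:Z ->
  mu (O : set (QpB p)) = ((size (codes O n0 d))%:R * bet (n0 + d%:Z))%:E.
Proof.
move=> Md; rewrite (measure_codes hp Hmu low (per_le Md)) (betE hp Hmu).
by rewrite -EFinM.
Qed.

(** The inner product of chi_l and chi_l' on [O], up to the measure of a small ball and
    normalisation ([inner_gram]). *)
Definition gram l l' k (d : nat) : R[i] :=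
  \sum_(c <- codes O n0 d) ec ((tr l k - tr l' k) * (pw p n0 * c%:R)).

Lemma chi_diff l l' x k m : tr l (- m) = 0 -> tr l' (- m) = 0 -> O x -> - n0 <= k ->
  ec (pfrac (qmul l x) - pfrac (qmul l' x)) = ec ((tr l k - tr l' k) * tr x m).
Proof.
move=> lm l'm Ox nk; apply/esym/ec_eq; rewrite mulrBl subrBB.
apply: rpredB; apply: (@pfrac_mul p hp _ x (- m) n0); rewrite ?opprK //; exact: low.
Qed.

Lemma inner_gram l l' k (d : nat) : M0 <= n0 + d%:Z ->
  tr l (- (n0 + d%:Z)) = 0 -> tr l' (- (n0 + d%:Z)) = 0 -> - n0 <= k ->
  (\int[mu]_(x in (O : set (QpB p)))
     ((chi_re R l x * chi_re R l' x + chi_im R l x * chi_im R l' x)%R)%:E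
   = (bet (n0 + d%:Z) * complex.Re (gram l l' k d))%:E /\
   \int[mu]_(x in (O : set (QpB p)))
     ((chi_im R l x * chi_re R l' x - chi_re R l x * chi_im R l' x)%R)%:E
   = (bet (n0 + d%:Z) * complex.Im (gram l l' k d))%:E)%E.
Proof.
move=> Md lm l'm nk; pose g x := ec ((tr l k - tr l' k) * tr x (n0 + d%:Z)).
have gc x y : tr x (n0 + d%:Z) = tr y (n0 + d%:Z) -> g x = g y by rewrite /g => ->.
have Eg : \sum_(c <- codes O n0 d) g (rep p n0 c) = gram l l' k d.
  rewrite /gram big_seq [RHS]big_seq; apply: eq_bigr => c cO.
  by rewrite /g tr_rep_nat // modn_small // (codes_lt cO).
rewrite -Eg -(integral_codes_re hp Hmu low (per_le Md) gc).
rewrite -(integral_codes_im hp Hmu low (per_le Md) gc).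
split; apply: eq_integral => x /set_mem Ox; rewrite /g -(chi_diff lm l'm Ox nk).
  by rewrite -ReM_ecN.
by rewrite -ImM_ecN.
Qed.

Lemma gram_zero l l' j k (d : nat) : vp_is (qsub l l') j ->
  tr l (- (n0 + d%:Z)) = 0 -> tr l' (- (n0 + d%:Z)) = 0 -> j < k ->
  gram l l' k d = 0 <-> adm_orders O (- j - 1).
Proof.
move=> vj lm l'm jk.
(* Both frequencies lie in p^(-(n0 + d)) Z_p, hence so does their difference. *)
have jd : - j - 1 < n0 + d%:Z.
  rewrite ltNge; apply/negP => h; have [_] := (vp_subE hp _ _ _).1 vj; apply.
  have h' : j + 1 <= - (n0 + d%:Z) by lia.
  by rewrite (tr0_le hp h' lm) (tr0_le hp h' l'm).
have [u Eu pu] := vp_diff hp vj jk.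
have [nj|jn] := lerP n0 (- j - 1).
  exact: (sum_branching br Eu pu nj jd (w0_codes d)).
(* Here chi_(l - l') is trivial on p^n0 Z_p: the sum is a nonzero cardinal, and - j - 1 is too low
   to be an order of [O]. *)
split=> [|/(branching_below hp br Ow low)]; last lia.
rewrite /gram sum_ec_zero => [/eqP|c _].
  by rewrite pnatr_eq0 -leqn0 leqNgt size_codes_gt0.
rewrite Eu; have : pz p 0 (pw p j * u%:~R * (pw p n0 * c%:R)).
  apply: (@pz_le _ hp _ (j + n0)); first lia.
  by apply: pzM => //; [apply: pz_pw|apply: pz_pw_nat].
by rewrite /pz pw0 divr1.
Qed.

Lemma common_level l l' m : exists d : nat,
  [/\ m <= n0 + d%:Z, M0 <= n0 + d%:Z, tr l (- (n0 + d%:Z)) = 0 & tr l' (- (n0 + d%:Z)) = 0].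
Proof.
have [n [nn ln l'n]] := tr_common_low hp l l' (Num.min (- M0) (- m)).
move: nn; rewrite le_min => /andP [h1 h2].
exists `|- n - n0|%N; rewrite (_ : n0 + _ = - n) ?opprK; last lia.
by split=> //; lia.
Qed.

Lemma orthogonalP l l' j : vp_is (qsub l l') j ->
  (((fine (mu (O : set (QpB p))))^-1)%:E *
       \int[mu]_(x in (O : set (QpB p)))
         ((chi_re R l x * chi_re R l' x + chi_im R l x * chi_im R l' x)%R)%:E = 0 /\
     ((fine (mu (O : set (QpB p))))^-1)%:E *
       \int[mu]_(x in (O : set (QpB p)))
         ((chi_im R l x * chi_re R l' x - chi_re R l x * chi_im R l' x)%R)%:E = 0)%E
  <-> adm_orders O (- j - 1).
Proof.
move=> vj; have [d [_ Md lm l'm]] := common_level l l' 0.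
pose k := Num.max (- n0) (j + 1).
have nk : - n0 <= k by rewrite le_max lexx.
have jk : j < k by rewrite lt_max; apply/orP; right; lia.
rewrite -(gram_zero vj lm l'm jk).
have [-> ->] := inner_gram Md lm l'm nk.
rewrite (muO Md) /= -!EFinM.
have b0 : bet (n0 + d%:Z) != 0 by rewrite gt_eqF // (bet_gt0 hp Hmu).
have c0 : ((size (codes O n0 d))%:R * bet (n0 + d%:Z))^-1 != 0.
  by rewrite invr_eq0 mulf_neq0 // pnatr_eq0 -lt0n size_codes_gt0.
split=> [[[/eqP h1] [/eqP h2]]|->]; last by rewrite !mulr0.
move: h1 h2; rewrite !mulf_eq0 (negPf b0) (negPf c0) /= => /eqP h1 /eqP h2.
by apply/eqP; rewrite eq_complex h1 h2 /= !eqxx.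
Qed.

Lemma norm1 l :
  (((fine (mu (O : set (QpB p))))^-1)%:E *
       \int[mu]_(x in (O : set (QpB p)))
         ((chi_re R l x * chi_re R l x + chi_im R l x * chi_im R l x)%R)%:E = 1 /\
     ((fine (mu (O : set (QpB p))))^-1)%:E *
       \int[mu]_(x in (O : set (QpB p)))
         ((chi_im R l x * chi_re R l x - chi_re R l x * chi_im R l x)%R)%:E = 0)%E.
Proof.
have [d [_ Md lm _]] := common_level l l 0.
have [-> ->] := inner_gram Md lm lm (lexx _).
have -> : gram l l (- n0) d = (size (codes O n0 d))%:R.
  by apply: sum_ec_zero => c _; rewrite subrr mul0r rpred0.
have -> : (size (codes O n0 d))%:R = Complex (size (codes O n0 d))%:R 0 :> R[i].
  by rewrite -[RHS]/((_)%:C)%C rmorph_nat.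
rewrite (muO Md) /= -!EFinM mulr0 mulr0; split=> //; congr (_%:E).
rewrite [bet _ * _]mulrC mulVf // mulf_neq0 ?gt_eqF ?(bet_gt0 hp Hmu) //.
by rewrite ltr0n size_codes_gt0.
Qed.

Lemma bet_codes (d d' : nat) : M0 <= n0 + d%:Z -> M0 <= n0 + d'%:Z ->
  (size (codes O n0 d))%:R * bet (n0 + d%:Z) =
  (size (codes O n0 d'))%:R * bet (n0 + d'%:Z) :> R.
Proof. by move=> h h'; apply: EFin_inj; rewrite -!muO. Qed.

Lemma ball_sub m s x : M0 <= m -> O s -> tr x m = tr s m -> O x.
Proof. by move=> Mm Os xs; apply: (per_le Mm Os). Qed.

(** * Counting the characters of a spectrum *)

Section Count.
Variables (L : set (Qp p)).
Hypothesis (sp : spectrum mu O L).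

Lemma spectrum_adm l l' j : L l -> L l' -> vp_is (qsub l l') j -> adm_orders O (- j - 1).
Proof.
move=> Ll Ll' vj; apply/(orthogonalP vj); have [+ _] := sp => /(_ l l' Ll Ll').
have -> : (l == l') = false; last by [].
apply/eqP => E; have [_] := (vp_subE hp _ _ _).1 vj.
by rewrite E.
Qed.

Variables (d : nat) (s : Qp p).
Hypotheses (Md : M0 <= n0 + d%:Z) (Os : O s).
Local Notation m := (n0 + d%:Z).
(** Frequencies in p^(-m) Z_p give the characters constant on cosets of p^m Z_p. The window of
    length d ends at - n0, beyond which a frequency acts trivially on p^n0 Z_p. *)
Local Notation AL := (codes L (- m) d).
Local Notation N := (size (codes O n0 d)).

Lemma AL_elem c : c \in AL -> exists l,
  [/\ L l, tr l (- m) = 0, code l (- m) d = c & tr l (- n0) = pw p (- m) * c%:R].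
Proof.
move=> /mem_codes [//|l [Ll lm lc]]; exists l; split=> //.
by rewrite -lc -codeE //; congr tr; lia.
Qed.

(* The projection of the indicator of the ball s + p^m Z_p onto the span of   *)
(* the characters of L that are constant on such balls is K / N.              *)
Let K x := \sum_(c <- AL) ec (pw p (- m) * c%:R * (tr x m - tr s m)).
Let r x : R[i] := (tr x m == tr s m)%:R - K x / N%:R.

Let r_level x y : tr x m = tr y m -> r x = r y.
Proof. by rewrite /r /K => ->. Qed.

Let K_fine x m' (q : rat) : m <= m' ->
  K x * ec (- (q * tr x m')) =
  \sum_(c <- AL) ec (- (pw p (- m) * c%:R * tr s m)) * ec ((pw p (- m) * c%:R - q) * tr x m').
Proof.
move=> mm'; rewrite /K mulr_suml; apply: eq_bigr => c _; rewrite -!ecD; apply: ec_eq.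
rewrite (_ : _ - _ = pw p (- m) * c%:R * (tr x m - tr x m')); last by ring.
have : pz p (- m + m) (pw p (- m) * c%:R * (tr x m - tr x m')).
  by apply: pzM => //; [apply: pz_pw_nat|apply: tr_cong].
by rewrite addNr /pz pw0 divr1.
Qed.

Lemma residual_orthogonal l (d' : nat) : L l -> m <= n0 + d'%:Z ->
  tr l (- (n0 + d'%:Z)) = 0 ->
  \sum_(a <- codes O n0 d') r (rep p n0 a) *
     ec (- (tr l (- n0) * tr (rep p n0 a) (n0 + d'%:Z))) = 0.
Proof.
move=> Ll dd' lm'; set m' := n0 + d'%:Z; set q := tr l (- n0); set A' := codes O n0 d'.
have Md' : M0 <= m' by apply: le_trans dd'.
have trA a : a \in A' -> tr (rep p n0 a) m' = pw p n0 * a%:R.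
  by move=> aA; rewrite /m' tr_rep_nat // modn_small // (codes_lt aA).
have N0 : N%:R != 0 :> R[i] by rewrite pnatr_eq0 -lt0n size_codes_gt0.
(* Orthogonality of the characters of L, summed at the finer level m' where chi_l is constant. *)
have inner c : c \in AL ->
    \sum_(a <- A') ec ((pw p (- m) * c%:R - q) * (pw p n0 * a%:R)) =
    if (tr l (- m) == 0) && (c == code l (- m) d) then (size A')%:R else 0.
  move=> /AL_elem [lc [Lc cm cc <-]].
  have [E|/eqP ne] := eqVneq lc l.
    rewrite E in cm cc *; rewrite cm cc !eqxx /=.
    by apply: sum_ec_zero => a _; rewrite subrr mul0r rpred0.
  have [j vj] := neq_split hp ne; have aj := spectrum_adm Lc Ll vj.
  have jn : j < - n0 by have := branching_below hp br Ow low aj; lia.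
  have cm' : tr lc (- m') = 0 by apply: (tr0_le hp _ cm); rewrite /m'; lia.
  have /(gram_zero vj cm' lm' jn) := aj; rewrite /gram => ->.
  case: andP => // -[/eqP lm /eqP cl]; case: ne.
  have : tr lc (- m + d%:Z) = tr l (- m + d%:Z) by apply/(code_inj hp) => //; rewrite cc.
  move=> E; have [_] := (vp_subE hp _ _ _).1 vj; case; apply: (tr_eq_le hp _ E); lia.
pose S : set (Qp p) := B s (- m).
have brS : branching S [set i | m <= i] := branching_ball hp s m.
have SO x : S x -> O x by rewrite /S BE /= => xs; apply: (ball_sub Md Os xs).
have lowS x : S x -> tr x n0 = 0 by move=> /SO /low.
have perS x y : S x -> tr x m' = tr y m' -> S y.
  by rewrite /S BE /= => <- xy; apply/esym/(tr_eq_le hp dd' xy).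
have sS : code s n0 d' \in codes S n0 d'.
  by apply/mem_codes => //; exists s; split=> //; apply: low.
have first : \sum_(a <- A') (tr (rep p n0 a) m == tr s m)%:R * ec (- (q * tr (rep p n0 a) m'))
    = \sum_(a <- codes S n0 d') ec (- q * (pw p n0 * a%:R)).
  rewrite (bigID (fun a => tr (rep p n0 a) m == tr s m)) /= [X in _ + X]big1 ?addr0; last first.
    by move=> a /negPf ->; rewrite mul0r.
  rewrite -big_filter; transitivity (\sum_(a <- [seq a <- A' | tr (rep p n0 a) m == tr s m])
      ec (- q * (pw p n0 * a%:R))).
    rewrite big_seq [RHS]big_seq; apply: eq_bigr => a; rewrite mem_filter => /andP [-> aA].
    by rewrite mul1r trA // mulNr.
  apply: perm_big; apply: uniq_perm; [exact/filter_uniq/codes_uniq|exact: codes_uniq|move=> a].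
  rewrite mem_filter; apply/andP/idP.
    move=> [/eqP E /mem_codes [//|x [Ox xn xa]]]; apply/mem_codes => //; exists x; split=> //.
    rewrite /S BE /= -E; apply: (tr_eq_le hp dd').
    by rewrite trA ?(codeE hp) ?xa //; apply/mem_codes => //; exists x.
  move=> /mem_codes [//|x [Sx xn xa]].
  have aA : a \in A' by apply/mem_codes => //; exists x; split=> //; apply: SO.
  split=> //; apply/eqP; move: (Sx); rewrite /S BE /= => <-; apply: (tr_eq_le hp dd').
  by rewrite trA // -xa -codeE.
under eq_bigr do rewrite mulrBl.
rewrite sumrB /= first.
have -> : \sum_(a <- A') K (rep p n0 a) / N%:R * ec (- (q * tr (rep p n0 a) m')) =
   N%:R^-1 * \sum_(c <- AL) ec (- (pw p (- m) * c%:R * tr s m)) *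
      (if (tr l (- m) == 0) && (c == code l (- m) d) then (size A')%:R else 0).
  under eq_bigr do rewrite mulrAC (K_fine _ _ dd').
  rewrite -mulr_suml mulrC; congr (_ * _); rewrite exchange_big /=.
  rewrite big_seq [RHS]big_seq; apply: eq_bigr => c cL.
  rewrite -mulr_sumr -inner //; congr (_ * _).
  by rewrite big_seq [RHS]big_seq; apply: eq_bigr => a aA; rewrite trA.
(* For l outside p^(-m) Z_p both terms vanish: no projection coefficient involves l, and chi_l is
   nontrivial on p^m Z_p, so it sums to zero over the ball around s. *)
have [lm|lm] := eqVneq (tr l (- m)) 0; last first.
  rewrite [X in _ * X]big1 ?mulr0 ?subr0 /=; last by move=> c _; rewrite mulr0.
  have [|j jm vj] := @tr_split p hp l (qp0 p) (- m); first exact/eqP.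
  have jn : j < - n0 by lia.
  have [u Eu pu] := vp_diff hp vj jn; rewrite subr0 -/q in Eu.
  have jl : - (n0 + d'%:Z) <= j.
    rewrite leNgt; apply/negP => h; have [_] := (vp_subE hp _ _ _).1 vj; apply.
    by rewrite (tr0_le hp _ lm') //; lia.
  apply/(@sum_branching S _ n0 d' (- q) j (- u) _ brS _ _ _ _ sS) => /=.
  - by rewrite Eu rmorphN mulrN.
  - by rewrite dvdzE abszN -dvdzE.
  - lia.
  - lia.
  - lia.
have cl : code l (- m) d \in AL by apply/mem_codes => //; exists l.
have qE : q = pw p (- m) * (code l (- m) d)%:R by rewrite -codeE // /q; congr tr; lia.
have -> : \sum_(c <- AL) ec (- (pw p (- m) * c%:R * tr s m)) *
    (if true && (c == code l (- m) d) then (size A')%:R else 0) =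
    ec (- (q * tr s m)) * (size A')%:R.
  rewrite (bigD1_seq _ cl (codes_uniq _ _ _)) eqxx -qE big1 /= ?addr0 //.
  by move=> c /negPf ->; rewrite mulr0.
have -> : \sum_(a <- codes S n0 d') ec (- q * (pw p n0 * a%:R)) =
    (size (codes S n0 d'))%:R * ec (- (q * tr s m)).
  rewrite big_seq (eq_bigr (fun=> ec (- (q * tr s m)))).
    by rewrite -big_seq big_const_seq count_predT iter_addr_0 mulr_natl.
  move=> a /mem_codes [//|x [Sx xn xa]]; apply: ec_eq.
  rewrite (_ : _ - _ = q * (tr s m - pw p n0 * a%:R)); last by ring.
  have : pz p (- m + m) (q * (tr s m - pw p n0 * a%:R)).
    apply: pzM => //; first by apply: tr_pz.
    rewrite -xa -codeE // -/m'; move: Sx; rewrite /S BE /= => /esym.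
    by move/(tr_eq hp _ _ (lexx m) dd').
  by rewrite addNr /pz pw0 divr1.
(* Each of the N balls has equally many pieces at level m'; this is read off from Haar measures. *)
have -> : (size A')%:R = N%:R * (size (codes S n0 d'))%:R :> R[i].
  rewrite -natrM; congr (_%:R); apply/eqP; rewrite -(eqr_nat R) natrM.
  have := bet_codes Md Md'; rewrite -/m' -/A'.
  have : mu (level_ball m (tr s m)) = ((size (codes S n0 d'))%:R * bet m')%:E.
    rewrite -[level_ball m _]/(_ : set (QpB p)) (_ : level_ball m (tr s m) = S); last by rewrite /S BE.
    by rewrite (measure_codes hp Hmu lowS perS) (betE hp Hmu) -EFinM.
  rewrite (mu_ball hp Hmu) (betE hp Hmu) => -[->].
  by rewrite mulrA => /(mulIf (lt0r_neq0 (bet_gt0 hp Hmu _))) ->.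
by rewrite [N%:R * _]mulrC mulrCA mulrA [_ * ec _]mulrC [_ / _ ]mulrC; field.
Qed.

(** By completeness the residual r is zero a.e., hence at s itself since it is constant on balls.
    There all terms of K equal 1, so 1 = #AL / N. *)
Lemma spectrum_count : size AL = N.
Proof.
have [_ complete] := sp.
pose u (x : QpB p) := complex.Re (r x); pose v (x : QpB p) := complex.Im (r x).
have mO := measO.
have L2r : L2 mu O u v.
  split; first by apply: (@level_meas_fun R p m) => // x y /r_level; rewrite /u => ->.
  split; first by apply: (@level_meas_fun R p m) => // x y /r_level; rewrite /v => ->.
  rewrite (integral_codes hp Hmu low (per_le Md)); last first.
    by move=> x y /r_level; rewrite /u /v => ->.
  by rewrite (betE hp Hmu); under eq_bigr do rewrite -EFinM; rewrite sumEFin ltry.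
have orth l : L l ->
   (\int[mu]_(x in (O : set (QpB p))) ((u x * chi_re R l x + v x * chi_im R l x)%R)%:E = 0 /\
    \int[mu]_(x in (O : set (QpB p))) ((v x * chi_re R l x - u x * chi_im R l x)%R)%:E = 0)%E.
  move=> Ll; have [d' [dd' Md' lm _]] := common_level l l m.
  have res := residual_orthogonal Ll dd' lm.
  pose g x := r x * ec (- (tr l (- n0) * tr x (n0 + d'%:Z))).
  have gc x y : tr x (n0 + d'%:Z) = tr y (n0 + d'%:Z) -> g x = g y.
    by move=> xy; rewrite /g xy (r_level (tr_eq_le hp dd' xy)).
  have chiO x : O x -> chi R l x = ec (tr l (- n0) * tr x (n0 + d'%:Z)).
    by move=> Ox; apply: (chiE R hp lm (low Ox)); rewrite ?opprK.
  have := integral_codes_re hp Hmu low (per_le Md') gc; rewrite /g res /= mulr0 => h1.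
  have := integral_codes_im hp Hmu low (per_le Md') gc; rewrite /g res /= mulr0 => h2.
  split; [apply: etrans h1|apply: etrans h2]; apply: eq_integral => x /set_mem Ox.
    by rewrite chi_reE chi_imE chiO // ec_conj_re.
  by rewrite chi_reE chi_imE chiO // ec_conj_im.
have ae := complete u v L2r orth.
have P0 : forall x, O x -> u x = 0 /\ v x = 0.
  apply: (@ae_level R p hp mu Hmu m (fun x => O x -> u x = 0 /\ v x = 0)) ae.
  move=> x y xy h Oy; have : O x by apply: (per_le Md Oy).
  by move/h; rewrite /u /v (r_level xy).
have [us vs] := P0 s Os.
have : r s = 0 by apply/eqP; rewrite eq_complex; apply/andP; split; apply/eqP.
rewrite /r eqxx /K sum_ec_zero; last by move=> c _; rewrite subrr mulr0 rpred0.
have N0 : N%:R != 0 :> R[i] by rewrite pnatr_eq0 -lt0n size_codes_gt0.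
move/eqP; rewrite subr_eq0 eq_sym => /eqP h; apply/eqP; rewrite -(eqr_nat R[i]).
by rewrite -[X in X == _](divfK N0) h mul1r.
Qed.

End Count.

(** The reflection j = - i - 1 carries the window [n0, m) of [O] onto the window [- m, - n0) of the
    frequencies with the order of levels reversed. *)
Lemma dual_levset m (d : nat) : n0 + d%:Z = m ->
  lev (levset [set j | exists i, adm_orders O i /\ j = - i - 1] (- m)) 0 d =
  lev (levset (adm_orders O) n0) 0 d.
Proof.
move=> Ed; rewrite -[RHS]lev_rev; apply: eq_lev => i /andP [_ id].
rewrite /levset; apply: asbool_equiv_eq; split.
  by move=> [i' [ai Ei]]; rewrite (_ : n0 + _ = i') //; lia.
by move=> h; eexists; split; [exact: h|lia].
Qed.

Lemma spectrum_phd L : spectrum mu O L -> p_homogeneous_discrete L /\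
  adm_orders L = [set j | exists i, adm_orders O i /\ j = - i - 1].
Proof.
move=> sp; set IL := [set j | _].
have ILE j : adm_orders O (- j - 1) -> IL j.
  by move=> h; exists (- j - 1); split=> //; lia.
have sepL l l' : L l -> L l' -> tr l (- n0) = tr l' (- n0) -> l = l'.
  move=> Ll Ll' E; apply: contrapT => /(neq_split hp) [j vj].
  have aj := spectrum_adm sp Ll Ll' vj; have := branching_below hp br Ow low aj => nj.
  have [_] := (vp_subE hp _ _ _).1 vj; apply; apply: (tr_eq_le hp _ E); lia.
apply: (@codes_phd p hp L IL (- n0) (- M0)) => //.
  by move=> j [i [ai ->]]; have := branching_below hp br Ow low ai; lia.
move=> n d nn Ed; pose m := n0 + d%:Z.
have Em : n = - m by rewrite /m; lia.
have Md : M0 <= n0 + d%:Z by lia.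
have sz := spectrum_count sp Md Ow; rewrite -/m -Em in sz.
have szO : size (codes O n0 d) = (p ^ lev (levset (adm_orders O) n0) 0 d)%N.
  have hO : hom p (codes O n0 d) (levset (adm_orders O) n0) d by apply: branching_hom.
  apply: hom_size hO _.
  by have := size_codes_gt0 d; case: (codes _ _ _).
split; last by have := size_codes_gt0 d; rewrite -sz; case: (codes _ _ _).
apply: (sep_hom hp).
- move=> i id nI a b /mem_codes [//|l [Ll ln la]] /mem_codes [//|l' [Ll' l'n lb]] ab.
  have [//|/eqP nab] := eqVneq (a %% p ^ i.+1)%N (b %% p ^ i.+1)%N.
  case/negP: nI; apply/asboolP; apply: ILE; apply: (spectrum_adm sp Ll Ll').
  apply/(vp_subE hp); split; first by apply/(code_eq hp ln l'n (ltnW id)); rewrite la lb.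
  rewrite (_ : n + i%:Z + 1 = n + i.+1%:Z); last lia.
  by move/(code_eq hp ln l'n id); rewrite la lb.
- by move=> c; apply: cnt_top => //; [apply: codes_uniq|apply: codes_lt].
- by rewrite sz szO Em (dual_levset (erefl _)).
Qed.

End OneSet.
End Spectrum.

(** * Homogeneous sets are spectra *)

Section BallGenerators.
Variables (p : nat) (hp : prime p) (m0 : int).

(** A pi-system of balls of radius at most p^(-m0), with the empty set added for stability under
    intersection. Centres are indexed by rationals, so open sets are countable unions of its
    members. *)
Definition small_balls : set (set (QpB p)) :=
  [set S | S = set0 \/ exists m r, m0 <= m /\ S = @level_ball p m r].

Lemma small_balls_setI : setI_closed small_balls.
Proof.
move=> A A' [->|[m [r [mm ->]]]]; first by left; rewrite set0I.
move=> [->|[m' [r' [mm' ->]]]]; first by left; rewrite setI0.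
wlog le : m r m' r' mm mm' / m <= m' => [H|].
  have [le|lt] := lerP m m'; first exact: H.
  by rewrite setIC; apply: H => //; apply: ltW.
have [->|/set0P [x [/= xm xm']]] := eqVneq (@level_ball p m r `&` @level_ball p m' r') set0; first by left.
right; exists m', r'; split=> //; apply/seteqP; split=> [y [] //|y ym']; split=> //.
rewrite /level_ball /= in xm xm' ym' *; rewrite -xm; apply: (tr_eq_le hp le).
by rewrite ym' xm'.
Qed.

Lemma measurable_small_balls : @measurable _ (QpB p) = <<s small_balls >>.
Proof.
apply/seteqP; split => S; last first.
  apply: smallest_sub; first exact: smallest_sigma_algebra.
  move=> _ [->|[m [r [_ ->]]]]; first exact: measurable0.
  exact: cball_meas.
apply: smallest_sub; first exact: smallest_sigma_algebra.
move=> U oU; pose T := g_sigma_algebraType small_balls.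
pose F (k : nat) (r : rat) : set T :=
  if `[< @level_ball p (m0 + k%:Z) r `<=` U >] then @level_ball p (m0 + k%:Z) r else set0.
have -> : U = \bigcup_k \bigcup_r F k r.
  apply/seteqP; split=> x.
    move=> /oU [n hn]; pose k := `|(m0 + n)%R|%N.
    exists k => //; exists (tr x (m0 + k%:Z)) => //; rewrite /F asboolT //.
    move=> y; rewrite /level_ball /= => h; apply: hn; rewrite /B /=.
    by apply: (tr_eq_le hp _ h); rewrite /k; lia.
  by move=> [k _ [r _]]; rewrite /F; case: asboolP => // h /h.
suff : @measurable _ T (\bigcup_k \bigcup_r F k r) by [].
apply: bigcupT_measurable => k; apply: bigcupT_measurable_rat => r.
rewrite /F; case: asboolP => // _; apply: sub_sigma_algebra; right.
by exists (m0 + k%:Z), r; split=> //; lia.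
Qed.

End BallGenerators.

(** * Completeness of the characters of a homogeneous dual set *)

Section Completeness.
Variables (R : realType) (p : nat) (hp : prime p).
Variables (mu : {measure set (QpB p) -> \bar R}) (Hmu : is_haar mu).
Implicit Types (k m n i j : int) (x y s l : Qp p).
Local Notation ec := (ec R).

Variables (O : set (Qp p)) (n0 M0 : int) (w0 : Qp p).
Hypotheses (low : forall x, O x -> tr x n0 = 0)
  (per0 : forall x y, O x -> tr x M0 = tr y M0 -> O y)
  (nM : n0 <= M0) (Ow : O w0) (br : branching O (adm_orders O)).

Let mO : measurable (O : set (QpB p)) := measO per0.

Lemma integrable_restrict (f : QpB p -> R) (E : set (QpB p)) : measurable E -> E `<=` O ->
  mu.-integrable O (EFin \o f) -> mu.-integrable E (EFin \o f).
Proof. by move=> mE EO; apply: integrableS. Qed.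

Lemma zero_on_balls_ae (f : QpB p -> R) m0 : M0 <= m0 -> mu.-integrable O (EFin \o f) ->
  (forall m s, m0 <= m -> O s -> (\int[mu]_(x in level_ball m (tr s m)) (f x)%:E = 0)%E) ->
  {ae mu, forall x : QpB p, O x -> f x = 0}.
Proof.
move=> Mm intf hf.
have /integrableP [mf _] := intf.
(* The Dynkin class, which contains the small balls and will be shown to contain every measurable
   set. *)
pose P (E : set (QpB p)) := (\int[mu]_(x in E `&` O) (f x)%:E = 0)%E.
have PT : P setT.
  rewrite /P setTI; pose d := `|m0 - n0|%N.
  have Ed : n0 + d%:Z = m0 by rewrite /d; lia.
  have perd : forall x y, O x -> tr x (n0 + d%:Z) = tr y (n0 + d%:Z) -> O y.
    by rewrite Ed; apply: per_le per0 _ Mm.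
  rewrite {1}(codes_cover hp low perd) integral_bigsetU_EFin.
  - rewrite big_seq big1 // => c /mem_codes [//|x [Ox xn <-]].
    by rewrite -codeE // Ed; apply: hf.
  - by move=> c; apply: cball_meas.
  - exact: codes_uniq.
  - exact: cball_triv.
  - by rewrite -codes_cover.
have PG : small_balls m0 `<=` P.
  move=> _ [->|[m [r [mm ->]]]]; first by rewrite /P set0I integral_set0.
  rewrite /P; have [->|/set0P [x [xr Ox]]] := eqVneq (level_ball m r `&` O) set0.
    by rewrite integral_set0.
  rewrite (_ : level_ball m r `&` O = level_ball m (tr x m)); first exact: hf.
  rewrite /level_ball /= in xr *; apply/seteqP; split=> y /=; first by move=> [-> _].
  rewrite xr => yr; split=> //; apply: (per_le hp per0 (le_trans Mm mm) Ox).
  by rewrite xr yr.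
have PC (S : set (QpB p)) : measurable S -> P S -> P (~` S).
  move=> mS PS.
  have E : (S `&` O) `|` (~` S `&` O) = O by rewrite -setIUl setUv setTI.
  have := PT; rewrite /P setTI -[X in (\int[mu]_(x in X) _ = _)%E -> _]E.
  rewrite (@integral_setU _ _ _ mu (S `&` O) (~` S `&` O) (EFin \o f)).
  - by rewrite [X in (X + _)%E]PS add0e.
  - exact: measurableI.
  - by apply: measurableI => //; apply: measurableC.
  - by rewrite E.
  - by apply/disj_set2P; rewrite setIACA setICr set0I.
have PU (F : (set (QpB p))^nat) : (forall n : nat, measurable (F n)) -> trivIset setT F ->
    (forall n : nat, P (F n)) -> P (\bigcup_k F k).
  move=> mF tF PF; rewrite /P setI_bigcupl.
  rewrite integral_bigcup.
  - by rewrite eseries0 // => q _ _; apply: PF.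
  - exact: trivIset_setIr.
  - by move=> q; apply: measurableI.
  - apply: integrable_restrict => //; last by move=> x [q _ []].
    by apply: bigcupT_measurable => q; apply: measurableI.
have all (E : set (QpB p)) : measurable E -> P E.
  move=> mE; apply: (dynkin_induction (measurable_small_balls hp m0) (small_balls_setI hp (m0 := m0)) PT PG PC PU).
  by rewrite -measurable_small_balls.
have := @integral_ae_eq _ _ _ mu O mO (cst 0%E) (EFin \o f) intf (measurable_cst _).
have hE : forall E : set (QpB p), E `<=` O -> measurable E ->
    (\int[mu]_(x in E) (EFin \o f) x = \int[mu]_(x in E) cst 0 x)%E.
  by move=> E EO /all; rewrite /P (setIidl EO) integral0.
move=> /(_ hE); apply: filterS => x h Ox; have [] := h Ox.
by [].
Qed.

(** [O] has finite measure and |u| <= 1 + u^2 + v^2; the squares (u - 1)^2 and (u + 1)^2 give the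
    two signs. *)
Lemma L2_integrable (u v : QpB p -> R) : L2 mu O u v ->
  mu.-integrable O (EFin \o u) /\ mu.-integrable O (EFin \o v).
Proof.
move=> [mu_ [mv fin]].
have msq : measurable_fun (O : set (QpB p)) (fun x => u x ^+ 2 + v x ^+ 2).
  by apply: measurable_funD; apply: measurable_funX.
have isq : mu.-integrable O (EFin \o (fun x => u x ^+ 2 + v x ^+ 2)).
  apply/integrableP; split; first exact/measurable_EFinP.
  rewrite (eq_integral (fun x : QpB p => (u x ^+ 2 + v x ^+ 2)%:E)) // => x _.
  by rewrite /= ger0_norm // addr_ge0 // sqr_ge0.
have i1 : mu.-integrable O (EFin \o cst 1).
  apply/integrableP; split; first exact/measurable_EFinP.
  have [d [_ Md _ _]] := common_level hp nM w0 w0 0.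
  rewrite (eq_integral (cst 1%E)); last by move=> x _; rewrite /= normr1.
  by rewrite integral_cst // mul1e (muO hp Hmu low per0 Md) ltry.
have isum := integrableD mO i1 isq.
split; apply: (le_integrable mO _ _ isum); try exact/measurable_EFinP.
  move=> x _ /=; rewrite lee_fin [leRHS]ger0_norm; last by rewrite !addr_ge0 ?sqr_ge0.
  by rewrite ler_norml; apply/andP; split; have := sqr_ge0 (u x - 1); have := sqr_ge0 (u x + 1); have := sqr_ge0 (v x); nra.
move=> x _ /=; rewrite lee_fin [leRHS]ger0_norm; last by rewrite !addr_ge0 ?sqr_ge0.
by rewrite ler_norml; apply/andP; split; have := sqr_ge0 (v x - 1); have := sqr_ge0 (v x + 1); have := sqr_ge0 (u x); nra.
Qed.

Lemma integrable_level_mul (f g : QpB p -> R) k : mu.-integrable O (EFin \o f) ->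
  (forall x y : QpB p, tr x k = tr y k -> g x = g y) -> (forall x, `|g x| <= 1) ->
  mu.-integrable O (EFin \o (fun x => f x * g x)).
Proof.
move=> intf gc g1; apply: (le_integrable mO _ _ intf).
  apply/measurable_EFinP; apply: measurable_funM.
    by have /integrableP [/measurable_EFinP] := intf.
  exact: level_meas_fun gc.
move=> x _ /=; rewrite lee_fin normrM -[leRHS]mulr1; apply: ler_wpM2l => //.
Qed.

Lemma chi_level l k x y : tr l (- k) = 0 -> tr x k = tr y k -> chi R l x = chi R l y.
Proof.
move=> lk xy; have [b [_ xb yb]] := tr_common_low hp x y 0.
have kk : - - k <= k by rewrite opprK.
by rewrite (chiE R hp lk xb (lexx _) kk) (chiE R hp lk yb (lexx _) kk) xy.
Qed.

Lemma ec_re_le1 q : `|complex.Re (ec q)| <= 1.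
Proof. by rewrite /= ler_norml cos_geN1 cos_le1. Qed.

Lemma ec_im_le1 q : `|complex.Im (ec q)| <= 1.
Proof. by rewrite /= ler_norml sin_geN1 sin_le1. Qed.

Section DualSet.
Variable (L : set (Qp p)).
Hypotheses (hL : p_homogeneous_discrete L)
  (aL : adm_orders L = [set j | exists i, adm_orders O i /\ j = - i - 1]).

Lemma dual_level j : adm_orders L j -> j < - n0.
Proof. by rewrite aL => -[i [ai ->]]; have := branching_below hp br Ow low ai; lia. Qed.

(** A Dirichlet kernel. If s and x split at i < m, then i is an order of [O], so L branches fully at
    - i - 1 and the sum of chi_l(s - x) vanishes. *)
Lemma dual_sum (d : nat) s x : O s -> O x -> let m := n0 + d%:Z in
  \sum_(c <- codes L (- m) d) ec (pw p (- m) * c%:R * tr s m - pw p (- m) * c%:R * tr x m) =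
  if tr x m == tr s m then (size (codes L (- m) d))%:R else 0.
Proof.
move=> Os Ox m.
have [E|ne] := eqVneq (tr x m) (tr s m).
  by apply: sum_ec_zero => c _; rewrite E subrr rpred0.
have [|i im vi] := @tr_split p hp s x m; first by apply/eqP; rewrite eq_sym.
have [u Eu pu] := vp_diff hp vi im.
have [E1 E2] := (vp_subE hp _ _ _).1 vi.
have ni : n0 <= i.
  rewrite leNgt; apply/negP => lt; apply: E2.
  by rewrite !(tr0_le hp _ (low _)) //; lia.
have ai : adm_orders O i.
  by exists s, x; split=> //; split=> //; split=> // E; apply: E2; rewrite E.
pose e := `|(m - 1 - i)%R|%N.
have Ee : - m + e%:Z = - i - 1 by rewrite /e; lia.
have ed : (e < d)%N by rewrite /e /m in im *; lia.
have [_ homL] := phd_codes hp hL dual_level.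
have hLd : hom p (codes L (- m) d) (levset (adm_orders L) (- m)) d by apply: homL; rewrite /m; lia.
have eqL : equi p (codes L (- m) d) e.
  apply: (hom_equi hp hLd ed); rewrite /levset Ee; apply/asboolP; rewrite aL.
  by exists i.
rewrite -[RHS]((@sum_ec R p hp _ (pw p i * u%:~R) (- m) e u _ pu).2 eqL); last first.
  by congr (pw p _ * _); lia.
by apply: eq_bigr => c _; rewrite -mulrBr Eu mulrC.
Qed.

Section Orthogonal.
Variables (u v : QpB p -> R).
Hypotheses (iu : mu.-integrable O (EFin \o u)) (iv : mu.-integrable O (EFin \o v)).
Hypothesis orth : forall l, L l ->
  (\int[mu]_(x in (O : set (QpB p))) ((u x * chi_re R l x + v x * chi_im R l x)%R)%:E = 0 /\
   \int[mu]_(x in (O : set (QpB p))) ((v x * chi_re R l x - u x * chi_im R l x)%R)%:E = 0)%E.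

Let Re := @complex.Re R.
Let Im := @complex.Im R.

(** The orthogonality relation for f = u + i v multiplied by the constant chi_l(s), real part
    only. *)
Lemma orth_shift (d : nat) s c : let m := n0 + d%:Z in c \in codes L (- m) d ->
  (\int[mu]_(x in (O : set (QpB p)))
    (u x * Re (ec (pw p (- m) * c%:R * tr s m - pw p (- m) * c%:R * tr x m)) -
     v x * Im (ec (pw p (- m) * c%:R * tr s m - pw p (- m) * c%:R * tr x m)))%:E = 0)%E.
Proof.
move=> m /mem_codes [//|l [Ll lm lc]].
pose q := pw p (- m) * c%:R.
have El : tr l (- n0) = q by rewrite /q -lc -codeE //; congr tr; rewrite /m; lia.
pose C (x : QpB p) := Re (ec (q * tr x m)); pose S (x : QpB p) := Im (ec (q * tr x m)).
have chiO x : O x -> chi R l x = ec (q * tr x m).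
  by move=> Ox; rewrite -El; apply: (chiE R hp lm (low Ox)); rewrite ?opprK.
have lC : forall x y : QpB p, tr x m = tr y m -> C x = C y by move=> x y; rewrite /C => ->.
have lS : forall x y : QpB p, tr x m = tr y m -> S x = S y by move=> x y; rewrite /S => ->.
have C1 x : `|C x| <= 1 by apply: ec_re_le1.
have S1 x : `|S x| <= 1 by apply: ec_im_le1.
have iuC := integrable_level_mul iu lC C1; have iuS := integrable_level_mul iu lS S1.
have ivC := integrable_level_mul iv lC C1; have ivS := integrable_level_mul iv lS S1.
pose g1 x := u x * C x + v x * S x; pose g2 x := v x * C x - u x * S x.
have i1 : mu.-integrable O (EFin \o g1) by apply: (integrableD mO iuC ivS).
have i2 : mu.-integrable O (EFin \o g2) by apply: (integrableB mO ivC iuS).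
have [ho1 ho2] := orth Ll.
have I1 : (\int[mu]_(x in (O : set (QpB p))) (EFin \o g1) x = 0)%E.
  rewrite -[RHS]ho1; apply: eq_integral => x /set_mem Ox.
  by rewrite chi_reE chi_imE chiO.
have I2 : (\int[mu]_(x in (O : set (QpB p))) (EFin \o g2) x = 0)%E.
  rewrite -[RHS]ho2; apply: eq_integral => x /set_mem Ox.
  by rewrite chi_reE chi_imE chiO.
pose a := Re (ec (q * tr s m)); pose b := Im (ec (q * tr s m)).
(* With f conj(chi_l) = g1 + i g2 and chi_l(s) = a + i b, the real part of the product is a g1 - b
   g2. *)
transitivity (\int[mu]_(x in (O : set (QpB p)))
    (a%:E * (EFin \o g1) x - b%:E * (EFin \o g2) x))%E.
  apply: eq_integral => x _; rewrite -!EFinM -EFinB; congr (_%:E).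
  rewrite /Re /Im -/q -ReM_ecN -ImM_ecN /g1 /g2 /a /b /C /S /Re /Im; ring.
rewrite integralB //; [|exact: integrableZl|exact: integrableZl].
by rewrite !integralZl // I1 I2 !mule0 sube0.
Qed.

(** Summing [orth_shift] over all residues of L in the window makes the kernel [dual_sum] isolate
    the ball around s; [l0] keeps the factor #A nonzero. *)
Lemma orth_ball (d : nat) s l0 : O s -> L l0 -> let m := n0 + d%:Z in M0 <= m ->
  tr l0 (- m) = 0 -> (\int[mu]_(x in level_ball m (tr s m)) (u x)%:E = 0)%E.
Proof.
move=> Os Ll0 m Mm l0m; set A := codes L (- m) d.
have A0 : (0 < size A)%N.
  have : code l0 (- m) d \in A by apply/mem_codes => //; exists l0.
  by case: A.
pose th (c : nat) x := pw p (- m) * c%:R * tr s m - pw p (- m) * c%:R * tr x m.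
pose h c (x : QpB p) := u x * Re (ec (th c x)) - v x * Im (ec (th c x)).
have ih c : mu.-integrable O (EFin \o h c).
  have i1 : mu.-integrable O (EFin \o (fun x => u x * Re (ec (th c x)))).
    apply: (@integrable_level_mul _ _ m) => // [x y|x]; first by rewrite /th => ->.
    exact: ec_re_le1.
  have i2 : mu.-integrable O (EFin \o (fun x => v x * Im (ec (th c x)))).
    apply: (@integrable_level_mul _ _ m) => // [x y|x]; first by rewrite /th => ->.
    exact: ec_im_le1.
  exact: (integrableB mO i1 i2).
have S0 : (\int[mu]_(x in (O : set (QpB p))) \sum_(c <- A) (EFin \o h c) x = 0)%E.
  rewrite (integral_sum mO ih) big_seq big1 // => c cA.
  exact: orth_shift.
have S1 : (\int[mu]_(x in (O : set (QpB p)))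
    ((size A)%:R%:E * (u x * (tr x m == tr s m)%:R)%:E) = 0)%E.
  rewrite -[RHS]S0; apply: eq_integral => x /set_mem Ox.
  rewrite sumEFin -EFinM; congr (_%:E).
  have := dual_sum d Os Ox; rewrite -/m -/A => K.
  rewrite /h sumrB -!mulr_sumr -!raddf_sum /= K.
  case: eqP => _; last by rewrite !mulr0 subr0.
  have -> : (size A)%:R = Complex (size A)%:R 0 :> R[i].
    by rewrite -[RHS]/((_)%:C)%C rmorph_nat.
  by rewrite /= mulr0 subr0 mulr1 mulrC.
have iub : mu.-integrable O (EFin \o (fun x => u x * (tr x m == tr s m)%:R)).
  apply: (@integrable_level_mul _ _ m) => //; first by move=> x y ->.
  by move=> x; case: eqP; rewrite ?normr1 ?normr0.
move: S1; rewrite (integralZl mO iub) => /eqP; rewrite mule_eq0 => /orP [|/eqP S1].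
  by rewrite eqe pnatr_eq0 -leqn0 leqNgt A0.
rewrite -[RHS]S1 integral_mkcond [RHS]integral_mkcond; apply: eq_integral => x _.
rewrite !patchE; have [xs|xs] := boolP (x \in level_ball m (tr s m)).
  have E : tr x m = tr s m by move/set_mem: xs.
  have Ox : O x := ball_sub hp per0 Mm Os E.
  by rewrite (mem_set Ox) /= E eqxx mulr1.
case: ifP => //= _; case: eqP => [E|_]; last by rewrite mulr0.
by case/negP: xs; apply/mem_set.
Qed.

End Orthogonal.

Lemma phd_spectrum : spectrum mu O L.
Proof.
split=> [l l' Ll Ll'|u v L2uv orth].
  have [<-|/eqP ne] := eqVneq l l'; first exact: (norm1 hp Hmu low per0 nM Ow).
  have [j vj] := neq_split hp ne.
  apply/(orthogonalP hp Hmu low per0 nM Ow br vj).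
  have : adm_orders L j by exists l, l'.
  by rewrite aL => -[i [ai ->]]; rewrite (_ : _ - 1 = i) //; lia.
have [iu iv] := L2_integrable L2uv.
have [l0 Ll0] : exists l, L l.
  (* L is nonempty: M0 is an order of [O], so its reflection is an order of L. *)
  have : adm_orders L (- M0 - 1).
    by rewrite aL; exists M0; split=> //; apply: (branching_above hp br Ow per0).
  by move=> [l [_ [Ll _]]]; exists l.
have [d0 [_ Md0 l0m _]] := common_level hp nM l0 l0 0.
have ball (f g : QpB p -> R) : mu.-integrable O (EFin \o f) -> mu.-integrable O (EFin \o g) ->
    (forall l, L l ->
      (\int[mu]_(x in (O : set (QpB p))) ((f x * chi_re R l x + g x * chi_im R l x)%R)%:E = 0 /\
       \int[mu]_(x in (O : set (QpB p))) ((g x * chi_re R l x - f x * chi_im R l x)%R)%:E = 0)%E) ->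
    {ae mu, forall x : QpB p, O x -> f x = 0}.
  move=> if_ ig og; apply: (zero_on_balls_ae Md0 if_) => m s mm Os.
  pose d := `|(m - n0)%R|%N; have Ed : n0 + d%:Z = m by rewrite /d; lia.
  rewrite -Ed; apply: (orth_ball if_ ig og Os Ll0); rewrite Ed.
    exact: le_trans mm.
  by apply: (tr0_le hp _ l0m); lia.
have hu := ball u v iu iv orth.
have hv : {ae mu, forall x : QpB p, O x -> v x = 0}.
  (* The imaginary part of f is the real part of - i f = v - i u, which is orthogonal to the same
     characters. *)
  apply: (ball v (fun x => u x * -1) iv).
    by apply: (@integrable_level_mul _ _ 0) => // x; rewrite normrN1.
  move=> l Ll; have [ho1 ho2] := orth l Ll; split.
    by rewrite -[RHS]ho2; apply: eq_integral => x _; rewrite mulrN1 mulNr.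
  transitivity (\int[mu]_(x in (O : set (QpB p)))
      - ((u x * chi_re R l x + v x * chi_im R l x)%R)%:E)%E.
    by apply: eq_integral => x _; rewrite -EFinN mulrN1 mulNr opprD.
  have [d [_ _ ld _]] := common_level hp nM l l 0.
  have i1 : mu.-integrable O (EFin \o (fun x => u x * chi_re R l x)).
    apply: (@integrable_level_mul _ _ (n0 + d%:Z)) => // [x y /(chi_level ld) xy|x].
      by rewrite !chi_reE xy.
    exact: ec_re_le1.
  have i2 : mu.-integrable O (EFin \o (fun x => v x * chi_im R l x)).
    apply: (@integrable_level_mul _ _ (n0 + d%:Z)) => // [x y /(chi_level ld) xy|x].
      by rewrite !chi_imE xy.
    exact: ec_im_le1.
  have := integralZl mO (integrableD mO i1 i2) (-1); rewrite [X in (_ * X)%E]ho1 mule0 => hz.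
  by rewrite -[RHS]hz; apply: eq_integral => x _; rewrite -EFinM mulN1r.
by apply: filterS2 hu hv => x hu hv Ox; split; [apply: hu|apply: hv].
Qed.

End DualSet.
End Completeness.

Theorem theorem5p1 (R : realType) (p : nat) (hp : prime p)
  (mu : {measure set (QpB p) -> \bar R}) (Hmu : is_haar mu)
  (O : set (Qp p)) (HOc : qp_compact O) (HOo : qp_open O)
  (HOh : p_homogeneous_set O) (HOpos : (0 < mu O)%E) :
  (forall L : set (Qp p),
     spectrum mu O L <->
     p_homogeneous_discrete L /\
     adm_orders L = [set j | exists i, adm_orders O i /\ j = - i - 1]) /\
  (forall T : set (Qp p),
     tiling_complement mu O T <->
     p_homogeneous_discrete T /\ adm_orders T = ~` adm_orders O).
Proof.
have [n0 [M1 [low per1]]] := compact_open_levels hp HOc HOo.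
have br := hom_set_branching hp HOh.
have [w Ow] : exists w, O w.
  have [E0|/set0P //] := eqVneq O set0.
  by move: HOpos; rewrite E0 measure0 ltxx.
pose M0 := Num.max n0 M1.
have nM : n0 <= M0 by rewrite le_max lexx.
have per x y : O x -> tr x M0 = tr y M0 -> O y.
  move=> Ox xy; apply: (per1 x) => //; apply: (tr_eq_le hp _ xy).
  by rewrite le_max lexx orbT.
split=> [L|T].
  split=> [|[hL aL]]; first exact: (spectrum_phd hp Hmu low per nM Ow br).
  exact: (phd_spectrum hp Hmu low per nM Ow br hL aL).
rewrite (tiling_exact hp Hmu T per).
by apply: (exact_tiling_phd hp low per nM _ br); exists w.
Qed.
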